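(* Let $n\ge3$, $\alpha\ge0$, $\beta>(n-1)/2$, let $k$ be a real constant, let $f\in L^2(\mathbb{R}^{n-1})$, and let $$u(x)=k\int_{\mathbb{R}^{n-1}}\left(\frac{x_n^{\alpha}}{|y-x|}\right)^{\beta} f(y')\,dy',\qquad x\in\mathbb{R}^n_+,\ y=(y',0).$$ Let $x$ be an arbitrary point in $\mathbb{R}^n_+$. The sharp coefficient $\mathcal{C}_{\alpha,\beta,2}(x)$ in the inequality $$|\nabla u(x)|\le\mathcal{C}_{\alpha,\beta,2}(x)\,\|f\|_2$$ is given by $$\mathcal{C}_{\alpha,\beta,2}(x)=\frac{C_{\alpha,\beta,2}}{x_n^{\beta(1-\alpha)+((3-n)/2)}},$$ where $$C_{\alpha,\beta,2}=|k|\beta\left\{\frac{\pi^{(n-1)/2}\,\Gamma\left(\frac{2\beta+3-n}{2}\right)}{\Gamma(\beta+2)}\left[\frac{2\alpha^2\beta(\beta+1)}{2\beta+1-n}-2\alpha(\beta+1)+\frac{2\beta+3-n}{2}\right]\right\}^{1/2}$$ for $(n-1)/2<\beta\le n-1$. The same formula for $C_{\alpha,\beta,2}$ holds for $\beta>n-1$ and $$\alpha\le\alpha_1=\frac{(1+\beta)(2\beta+1-n)-\sqrt{(1+\beta)(2\beta+1-n)(\beta+1-n)}}{2\beta(1+\beta)},$$ or $$\alpha\ge\alpha_2=\frac{(1+\beta)(2\beta+1-n)+\sqrt{(1+\beta)(2\beta+1-n)(\beta+1-n)}}{2\beta(1+\beta)}.$$ If $\beta>n-1$ and $\alpha_1<\alpha<\alpha_2$,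 then $$C_{\alpha,\beta,2}=|k|\beta\left\{\frac{\pi^{(n-1)/2}\,\Gamma\left(\frac{2\beta+3-n}{2}\right)}{2\Gamma(\beta+2)}\right\}^{1/2}.$$ If (i) $(n-1)/2<\beta\le n-1$, or (ii) $\beta>n-1$ and $\alpha\le\alpha_1$ or $\alpha\ge\alpha_2$, then the coefficient $\mathcal{C}_{\alpha,\beta,2}(x)$ is sharp also in the weaker inequality obtained by replacing $\nabla u$ by $\partial u/\partial x_n$.
   Context: $\mathbb{R}^n_+=\{x=(x',x_n):x'\in\mathbb{R}^{n-1},\ x_n>0\}$. $\|\cdot\|_2$ is the norm of $L^2(\mathbb{R}^{n-1})$ (real-valued functions). ''Sharp coefficient'' at a given $x$ means the smallest constant for which the inequality holds for all $f\in L^2(\mathbb{R}^{n-1})$. *)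

(* Defs.v *)
(* Points of R^n are row vectors, normed by the library with the sup norm (the
   topology is the usual one); Euclidean lengths are [enorm].  The integration
   variable y' in R^(n-1) is an (n-1)-tuple, the finite power that the library
   equips with a sigma-algebra; its component type is [measurableTypeR R], i.e.
   R with its Borel sets.  Generic definitions use d = n - 1, so that the half
   space lies in 'rV[R]_d.+1 and its distinguished coordinate is [ord_max]. *)
From HB Require Import structures.
From mathcomp Require Import all_boot all_order all_algebra.
From mathcomp Require Import all_classical all_reals all_analysis.

Set Implicit Arguments.
Unset Strict Implicit.
Unset Printing Implicit Defensive.

Import Order.TTheory GRing.Theory Num.Theory.
Import numFieldNormedType.Exports.

Local Open Scope classical_set_scope.
Local Open Scope ring_scope.

Section LebesgueTuple.
Context (R : realType).

Definition tuple_cons (d : nat) (p : measurableTypeR R * d.-tuple (measurableTypeR R)) :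
    d.+1.-tuple (measurableTypeR R) := [tuple of p.1 :: p.2].

Lemma measurable_tuple_cons (d : nat) : measurable_fun setT (@tuple_cons d).
Proof. exact: measurable_cons. Qed.

Definition lebesgue_cons (d : nat)
    (m : {sigma_finite_measure set (d.-tuple (measurableTypeR R)) -> \bar R}) :=
  pushforward (lebesgue_measure \x m)%E (@tuple_cons d).

Section Cons.
Variables (d : nat)
  (m : {sigma_finite_measure set (d.-tuple (measurableTypeR R)) -> \bar R}).

Let lebesgue_cons0 : lebesgue_cons m set0 = 0%E.
Proof. by rewrite /lebesgue_cons /pushforward preimage_set0 measure0. Qed.

Let lebesgue_cons_ge0 A : (0 <= lebesgue_cons m A)%E.
Proof. by rewrite /lebesgue_cons /pushforward; exact: measure_ge0. Qed.

Let lebesgue_cons_sigma_additive : semi_sigma_additive (lebesgue_cons m).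
Proof.
move=> F mF tF mUF; rewrite /lebesgue_cons /pushforward preimage_bigcup.
have mpre B : measurable B -> measurable (@tuple_cons d @^-1` B).
  by move=> mB; rewrite -[X in measurable X]setTI; exact: measurable_tuple_cons.
apply: measure_semi_sigma_additive => [n||]; first exact: mpre.
- apply/trivIsetP => /= i j _ _ ij; rewrite -preimage_setI.
  by move/trivIsetP : tF => /(_ _ _ _ _ ij) ->//; rewrite preimage_set0.
- by rewrite -preimage_bigcup; exact: mpre.
Qed.

HB.instance Definition _ := isMeasure.Build _ _ _ (lebesgue_cons m)
  lebesgue_cons0 lebesgue_cons_ge0 lebesgue_cons_sigma_additive.

Lemma lebesgue_cons_sigma_finite : sigma_finite setT (lebesgue_cons m).
Proof.
have /sigma_finiteP[F [TF ndF Foo]] :=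
  @sigma_finiteT _ _ _ (@lebesgue_measure R).
have /sigma_finiteP[G [TG ndG Goo]] := sigma_finiteT m.
pose unc (t : d.+1.-tuple (measurableTypeR R)) := (thead t, [tuple of behead t]).
have munc : measurable_fun setT unc.
  apply: measurable_fun_pair; last exact: measurable_behead.
  exact: measurable_tnth.
have uncK p : unc (tuple_cons p) = p.
  case: p => a t; rewrite /unc theadE; congr pair.
  exact: val_inj.
exists (fun n => unc @^-1` (F n `*` G n)).
  apply/seteqP; split=> // t _.
  have [n _ Fn] : (\bigcup_n F n) (unc t).1 by rewrite -TF.
  have [k _ Gk] : (\bigcup_n G n) (unc t).2 by rewrite -TG.
  exists (maxn n k) => //; split.
  - by move: (unc t).1 Fn; exact/subsetPset/ndF/leq_maxl.
  - by move: (unc t).2 Gk; exact/subsetPset/ndG/leq_maxr.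
move=> k; have [mF Fk] := Foo k; have [mG Gk] := Goo k; split.
  by rewrite -[X in measurable X]setTI; apply: munc => //; exact: measurableX.
rewrite /lebesgue_cons /pushforward.
rewrite (_ : tuple_cons (d:=d) @^-1` _ = F k `*` G k); last first.
  by rewrite -comp_preimage (_ : unc \o _ = id) ?preimage_id//; apply/funext.
by rewrite product_measure1E// lte_mul_pinfty// ge0_fin_numE.
Qed.

HB.instance Definition _ := Measure_isSigmaFinite.Build _ _ _ (lebesgue_cons m)
  lebesgue_cons_sigma_finite.

End Cons.

(* d-dimensional Lebesgue measure on the Borel sets: the iterated product of
   the one-dimensional one.  Since every Lebesgue measurable function agrees
   almost everywhere with a Borel function, Borel L^2 functions represent all
   of L^2. *)
Fixpoint lebesgue_tuple (d : nat) :
    {sigma_finite_measure set (d.-tuple (measurableTypeR R)) -> \bar R} :=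
  match d with
  | 0 => \d_([tuple] : 0.-tuple (measurableTypeR R))
  | d'.+1 => lebesgue_cons (lebesgue_tuple d')
  end.

Lemma lebesgue_tuple_box (d : nat) (A : 'I_d -> set (measurableTypeR R)) :
  (forall i, measurable (A i)) ->
  lebesgue_tuple d [set t | forall i, A i (tnth t i)] =
  (\prod_(i < d) lebesgue_measure (A i))%E.
Proof.
elim: d A => [|d IH] A mA.
  rewrite big_ord0 /= diracE mem_set//; by case.
rewrite big_ord_recl /= /lebesgue_cons /pushforward.
rewrite (_ : _ @^-1` _ = A ord0 `*`
    [set t | forall i, A (lift ord0 i) (tnth t i)]); last first.
  apply/seteqP; split=> -[a t] /=.
    move=> H; split; first by have := H ord0.
    by move=> i; have := H (lift ord0 i); rewrite tnthS.
  move=> [H0 H1] i; case: (unliftP ord0 i) => [j ->|->] //.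
  by rewrite tnthS.
rewrite product_measure1E//.
  by congr (_ * _)%E; exact: (IH (fun i => A (lift ord0 i))).
rewrite (_ : [set t | _] = \bigcap_(i in [set: 'I_d])
    ((fun t : d.-tuple (measurableTypeR R) => tnth t i) @^-1` A (lift ord0 i))).
  apply: fin_bigcap_measurable => [|i _]; first exact: finite_finset.
  by rewrite -[X in measurable X]setTI; apply: measurable_tnth.
by apply/seteqP; split=> t /= H i; [move=> _; exact: H|exact: (H i I)].
Qed.

End LebesgueTuple.

Section HalfSpacePotential.
Context {R : realType}.

Definition enorm (d : nat) (v : 'rV[R]_d) : R :=
  Num.sqrt (\sum_(i < d) v 0 i ^+ 2).

Definition last_coord (d : nat) (x : 'rV[R]_d.+1) : R := x 0 ord_max.

Definition half_space (d : nat) : set 'rV[R]_d.+1 :=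
  [set x | 0 < last_coord x].

(* [y' |-> (y', 0)] *)
Definition boundary_point (d : nat) (y : d.-tuple (measurableTypeR R)) :
    'rV[R]_d.+1 :=
  \row_i (if unlift ord_max i is Some j then (tnth y j : R) else 0).

(* Both are meaningful only where [u] is differentiable: ['D_v u x] is a total
   operator. *)
Definition partial (d : nat) (i : 'I_d) (u : 'rV[R]_d -> R) (x : 'rV[R]_d) : R :=
  'D_(delta_mx 0 i) u x.

Definition gradient (d : nat) (u : 'rV[R]_d -> R) (x : 'rV[R]_d) : 'rV[R]_d :=
  \row_i partial i u x.

Definition L2 (d : nat) : {pred (d.-tuple (measurableTypeR R) -> R)} :=
  Lfun (lebesgue_tuple R d) 2%:E.
Arguments L2 d : clear implicits.

Definition L2norm (d : nat) (f : d.-tuple (measurableTypeR R) -> R) : R :=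
  fine 'N[lebesgue_tuple R d]_(2%:E)[EFin \o f]%E.

Definition potential_integrand (d : nat) (alpha beta : R)
    (f : d.-tuple (measurableTypeR R) -> R) (x : 'rV[R]_d.+1)
    (y : d.-tuple (measurableTypeR R)) : R :=
  (last_coord x `^ alpha / enorm (boundary_point y - x)) `^ beta * f y.

Definition potential (d : nat) (k alpha beta : R)
    (f : d.-tuple (measurableTypeR R) -> R) (x : 'rV[R]_d.+1) : R :=
  k * \int[lebesgue_tuple R d]_y potential_integrand alpha beta f x y.

(* [C] is the smallest constant such that [Q f <= C * ||f||_2] on [L^2]. *)
Definition sharp_coefficient (d : nat)
    (Q : (d.-tuple (measurableTypeR R) -> R) -> R) (C : R) : Prop :=
  (forall f, f \in L2 d -> Q f <= C * L2norm f) /\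
  (forall C', (forall f, f \in L2 d -> Q f <= C' * L2norm f) -> C <= C').

(* Euler's integral, convergent for [0 < z]. *)
Definition Gamma (z : R) : R :=
  \int[lebesgue_measure]_(t in `]0, +oo[) (t `^ (z - 1) * expR (- t)).

Definition alpha1 (n : nat) (beta : R) : R :=
  ((1 + beta) * (2 * beta + 1 - n%:R)
   - Num.sqrt ((1 + beta) * (2 * beta + 1 - n%:R) * (beta + 1 - n%:R)))
  / (2 * beta * (1 + beta)).

Definition alpha2 (n : nat) (beta : R) : R :=
  ((1 + beta) * (2 * beta + 1 - n%:R)
   + Num.sqrt ((1 + beta) * (2 * beta + 1 - n%:R) * (beta + 1 - n%:R)))
  / (2 * beta * (1 + beta)).

Definition C_outer (n : nat) (k alpha beta : R) : R :=
  `|k| * beta * Num.sqrt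
    (pi `^ ((n%:R - 1) / 2) * Gamma ((2 * beta + 3 - n%:R) / 2)
       / Gamma (beta + 2)
     * (2 * alpha ^+ 2 * beta * (beta + 1) / (2 * beta + 1 - n%:R)
        - 2 * alpha * (beta + 1) + (2 * beta + 3 - n%:R) / 2)).

Definition C_inner (n : nat) (k beta : R) : R :=
  `|k| * beta * Num.sqrt
    (pi `^ ((n%:R - 1) / 2) * Gamma ((2 * beta + 3 - n%:R) / 2)
       / (2 * Gamma (beta + 2))).

End HalfSpacePotential.
Arguments L2 {R} d.

(* Main.v *)
From HB Require Import structures.
Require Import Defs.
From mathcomp Require Import all_boot all_order all_algebra.
From mathcomp Require Import all_classical all_reals all_analysis.
From mathcomp Require Import measurable_realfun ring lra.

Set Implicit Arguments.
Unset Strict Implicit.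
Unset Printing Implicit Defensive.

Import Order.TTheory GRing.Theory Num.Theory.
Import numFieldNormedType.Exports.

Local Open Scope classical_set_scope.
Local Open Scope ring_scope.

(** Write [d = n - 1], [h = x_n] and [rho = |y - x|^2].  Differentiating under
    the integral sign, every partial derivative of [u] at [x] is, up to the
    common factor [k beta h^(alpha beta - 1)], the L^2 inner product of [f] with
    an explicit kernel [g_i] ([grad_kernel]):
    - [g_j = h (y_j - x_j) rho^(- beta/2 - 1)] in the tangential directions,
    - [g_n = alpha rho^(- beta/2) - h^2 rho^(- beta/2 - 1)] in the normal one.
    Each [g_j] is odd under the reflection of [y_j] about [x_j], which leaves
    the other kernels unchanged, so that the [g_i] are pairwise orthogonal.
    Bessel's inequality then bounds the sum of the squares of the inner products
    by [max_i ||g_i||^2 * ||f||^2], an equality when [f] is the longest kernel.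
    Hence the sharp coefficient is [|k| beta h^(alpha beta - 1) max_i ||g_i||]
    ([sharp_gradient]); it is also the one of the single derivative whose kernel
    is the longest.

    The norms reduce to the integrals of [rho^(-s)] and of
    [(y_j - x_j)^2 rho^(-s)].  They are computed by subordination to Gaussian
    functions: [Gamma s * rho^(-s)] is the integral over [t > 0] of
    [t^(s-1) exp(- t rho)], and once the integrals are exchanged the variables
    [y_j] separate ([subordination]).  The tangential kernels have the squared
    norm [S / 2] and the normal one has [S * F], where [S] is [gram_scale] and
    [F] is [gram_factor].  Up to a positive factor, [F - 1/2] is a quadratic
    polynomial in [alpha] with roots [alpha1] and [alpha2] that are real when
    [beta >= d]; its sign decides which kernel is the longest ([gram_factor_outer],
    [gram_factor_inner]).

    Differentiability holds in the sense of Frechet.  The quotient of the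
    potential kernels at [v + x] and [x] is [t^p s^q], where [t] and [s] are the
    quotients of the heights and of the squared distances; both are [1 + O(|v|)]
    uniformly in [y] because [rho >= h^2].  The differentiability of [t^p] and
    [s^q] at 1 thus gives an expansion whose remainder is at most
    [e |v| K(x, y) |f y|] ([kernel_first_order]), and this can be integrated. *)

(** * Affine changes of variable on the line *)

Section AffineSubstitution.
Context {R : realType}.
Notation mu := (@lebesgue_measure R).

Lemma ge0_integral_opp (f : R -> \bar R) :
  measurable_fun [set: R] f -> (forall t, 0 <= f t)%E ->
  (\int[mu]_t f (- t)%R = \int[mu]_t f t)%E.
Proof.
move=> mf f0.
have := @ge0_integral_pushforward _ _ _ _ R
  (-%R : measurableTypeR R -> measurableTypeR R) (@oppr_measurable R setT)
  mu setT f measurableT mf (fun y _ => f0 y).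
rewrite preimage_setT => <-.
apply: eq_measure_integral => //= A mA _.
by rewrite ?lebesgue_measureN//; exact: lebesgue_measureN.
Qed.

Lemma ge0_integral_affine (a b : R) (f : R -> \bar R) : 0 < a ->
  measurable_fun [set: R] f -> (forall t, 0 <= f t)%E ->
  (\int[mu]_t f (a * t + b)%R = a^-1%:E * \int[mu]_t f t)%E.
Proof.
move=> a0 mf f0.
pose phi (t : measurableTypeR R) : measurableTypeR R := a * t + b.
have mphi : measurable_fun setT phi.
  by apply: measurable_funD => //; exact: measurable_funM.
have := @ge0_integral_pushforward _ _ _ _ R phi mphi mu setT f measurableT mf
  (fun y _ => f0 y).
rewrite preimage_setT /comp => <-.
have anng : 0 <= a by exact: ltW.
have ainv : (0 <= a^-1) by rewrite invr_ge0.
rewrite -[a^-1]/((NngNum ainv)%:num) -ge0_integral_mscale//.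
apply: eq_measure_integral => //= A mA _.
pose nu : {measure set (measurableTypeR R) -> \bar R} :=
  mscale (NngNum anng) (pushforward mu phi).
have nuE X : ocitv X -> mu X = nu mphi X.
  case=> -[u v] _ <-; rewrite /nu/=/mscale/= /pushforward/=.
  transitivity (a%:E * mu `]((u - b) / a)%R, ((v - b) / a)%R])%E; last first.
    congr (_ * mu _)%E; apply/seteqP; split=> t/=;
      by rewrite /phi !in_itv/= ler_pdivlMr// ltr_pdivrMr// [a * t]mulrC
        ltrBlDr lerBrDr.
  rewrite !lebesgue_measure_itv/= !lte_fin ltr_pM2r ?invr_gt0// ltrD2r.
  case: ifPn => _; last by rewrite mule0.
  by rewrite -!EFinB -EFinM; congr EFin; field; rewrite gt_eqF.
rewrite /mscale/= (lebesgue_measure_unique nuE mA) /nu /mscale/=.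
by rewrite muleA -EFinM mulVf ?gt_eqF// mul1e.
Qed.

End AffineSubstitution.

(** * Integrals over a ray *)

Section ExponentialLayers.
Context {R : realType}.
Notation mu := (@lebesgue_measure R).

Lemma ge0_integral_ray (f F : R -> R) (a l : R) :
  (forall x, a <= x -> 0 <= f x) ->
  (forall x, a <= x -> {for x, continuous f}) ->
  (forall x, a <= x -> is_derive x 1 F (f x)) ->
  F x @[x --> +oo] --> l ->
  (\int[mu]_(x in `[a, +oo[) (f x)%:E = (l - F a)%:E)%E.
Proof.
move=> f0 cf dF Fl; rewrite (@ge0_continuous_FTC2y _ f F a l)// ?EFinB//.
- apply: continuous_in_subspaceT => x; rewrite inE/= in_itv/= andbT.
  exact: cf.
- by move=> x /ltW /dF [].
- apply: cvg_at_right_filter; apply: differentiable_continuous.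
  by apply/derivable1_diffP; have [] := dF a (lexx _).
- move=> x; rewrite in_itv/= andbT => /ltW /dF [_ <-].
  by rewrite derive1E.
Qed.

Lemma powRN_cvgy0 (p : R) : 0 < p -> b `^ (- p) @[b --> +oo] --> (0 : R).
Proof.
move=> p0; rewrite (_ : (fun b => _) = (fun b => b^-1 `^ p)); last first.
  apply/funext => b; have [b0|b0] := leP 0 b.
    by rewrite -powR_inv1// -powRrM mulN1r.
  by rewrite !lt0_powR1// invr_lt0.
apply: (@cvg_comp _ _ _ GRing.inv (fun a => a `^ p) _ (0^'+)); last first.
  exact: powR_cvg0.
move=> A [e /= e0 eA]; exists e^-1; split; first exact: num_real.
move=> b eb; have b0 : 0 < b by apply: lt_trans eb; rewrite invr_gt0.
apply: eA; last by rewrite invr_gt0.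
rewrite /ball_/= sub0r normrN gtr0_norm ?invr_gt0//.
by rewrite -[e]invrK ltf_pV2// posrE ?invr_gt0.
Qed.

Lemma integral_powR_tail (z : R) : 0 < z ->
  (\int[mu]_(b in `[1%R, +oo[) (b `^ (- z - 1))%:E = z^-1%:E)%E.
Proof.
move=> z0; pose F (b : R) : R := - z^-1 * b `^ (- z).
have x0 (x : R) : 1 <= x -> 0 < x by exact: lt_le_trans.
transitivity ((0 - F 1)%:E); last by rewrite /F powR1 mulr1 sub0r opprK.
apply: ge0_integral_ray; rewrite /F.
- by move=> x _; exact: powR_ge0.
- move=> x /x0 ?; apply: differentiable_continuous.
  by apply/derivable1_diffP/derivable_powR; rewrite in_itv/= andbT.
- move=> x /x0 ?.
  apply: (is_derive_eq (is_deriveZ (- z^-1) (is_derive1_powR (- z) _))) => //.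
  by rewrite /GRing.scale/= mulrA mulrNN mulVf ?gt_eqF// mul1r.
- rewrite -[X in _ --> X](mulr0 (- z^-1)).
  by apply: cvgMr; exact: powRN_cvgy0.
Qed.

(** With [integral_powR_tail], the two one-dimensional integrals in the trick
    of [ge0_integral_expR_layer]. *)
Lemma integral_expR_tail (c : R) : 0 < c ->
  (\int[mu]_(b in `[1%R, +oo[) (c * expR (- (b * c)))%:E = (expR (- c))%:E)%E.
Proof.
move=> c0; pose F (b : R) : R := - expR (- (b * c)).
transitivity ((0 - F 1)%:E); last by rewrite /F mul1r sub0r opprK.
apply: ge0_integral_ray; rewrite /F.
- by move=> x _; rewrite mulr_ge0 ?expR_ge0 ?ltW.
- move=> x _; apply: continuousM; first exact: cvg_cst.
  apply: continuous_comp; last exact: continuous_expR.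
  by apply: continuousN; apply: continuousM => //; exact: cvg_cst.
- move=> x _; apply: is_derive_eq; rewrite /GRing.scale/=. 
  by ring.
- rewrite -oppr0; apply: cvgN.
  apply: (@cvg_comp _ _ _ (fun b => b * c) (fun b => expR (- b)) _ +oo%R).
    by apply: gt0_cvgMly => //; exact: cvg_id.
  exact: cvgr_expR.
Qed.
End ExponentialLayers.

Section Layer.
Context {R : realType}.
Notation mu := (@lebesgue_measure R).

(** An integration by parts in disguise.  For [c > 0], [exp(-c)] is the integral
    over [b >= 1] of [c exp(- b c)].  Applying this with [c = phi x] and
    exchanging the integrals, the homogeneity hypothesis turns the inner one
    into [b^(-z-1)] times a constant, and [b^(-z-1)] integrates to [1 / z].  It
    yields both the functional equation of Gamma and the second Gaussian moment. *)
Lemma ge0_integral_expR_layer d (T : measurableType d)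
    (m : {sigma_finite_measure set T -> \bar R}) (w phi : T -> R) (z : R) :
  0 < z -> measurable_fun setT w -> measurable_fun setT phi ->
  (forall x, 0 <= w x) -> (forall x, w x != 0 -> 0 < phi x) ->
  (forall b : R, (1 <= b)%R ->
    \int[m]_x (w x * phi x * expR (- (b * phi x)))%:E =
    (b `^ (- z - 1))%:E * \int[m]_x (w x * phi x * expR (- phi x))%:E)%E ->
  (\int[m]_x (w x * expR (- phi x))%:E =
   z^-1%:E * \int[m]_x (w x * phi x * expR (- phi x))%:E)%E.
Proof.
move=> z0 mw mphi w0 phi0 hom.
pose M := (\int[m]_x (w x * phi x * expR (- phi x))%:E)%E.
have wphi0 x : 0 <= w x * phi x.
  have [->|/phi0 p0] := eqVneq (w x) 0; first by rewrite mul0r.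
  by rewrite mulr_ge0// ltW.
pose F (p : T * measurableTypeR R) : \bar R :=
  (w p.1 * phi p.1 * expR (- (p.2 * phi p.1)) * \1_(`[1, +oo[) p.2)%:E.
have mF : measurable_fun setT F.
  apply/measurable_EFinP; apply: measurable_funM; last first.
    by apply: measurableT_comp => //; exact: measurable_indic.
  apply: measurable_funM.
    by apply: measurable_funM; apply: measurableT_comp.
  apply: measurableT_comp => //; apply: measurableT_comp => //.
  by apply: measurable_funM => //; exact: measurableT_comp.
have F0 p : (0 <= F p)%E by rewrite lee_fin mulr_ge0// mulr_ge0// expR_ge0.
have F1 x : (\int[mu]_b F (x, b) = (w x * expR (- phi x))%:E)%E.
  transitivity (\int[mu]_(b in `[1%R, +oo[)
      ((w x)%:E * (phi x * expR (- (b * phi x)))%:E))%E.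
    rewrite [RHS]integral_mkcond; apply: eq_integral => b _.
    by rewrite /F/= patchE indicE; case: ifPn => _;
      rewrite ?mulr1 ?mulr0// -EFinM mulrA.
  have [wx0|/[dup] wx0 /phi0 p0] := eqVneq (w x) 0.
    by rewrite wx0 mul0r; apply: integral0_eq => b _; rewrite mul0e.
  rewrite ge0_integralZl ?lee_fin//.
  - by rewrite integral_expR_tail.
  - apply/measurable_EFinP; apply: measurable_funM => //.
    apply: measurableT_comp => //; apply: measurableT_comp => //.
    exact: measurable_funM.
  - by move=> b _; rewrite lee_fin mulr_ge0 ?expR_ge0// ltW.
have F2 b : (\int[m]_x F (x, b) =
    M * ((fun b => (b `^ (- z - 1))%:E) \_ `[1%R, +oo[) b)%E.
  rewrite patchE /F/= indicE; case: ifPn => [|_]; last first.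
    by rewrite mule0; apply: integral0_eq => x _; rewrite mulr0.
  rewrite inE/= in_itv/= andbT => b1.
  by rewrite muleC -hom//; apply: eq_integral => x _; rewrite mulr1.
under eq_integral do rewrite -F1.
rewrite fubini_tonelli//.
under eq_integral do rewrite F2.
rewrite ge0_integralZl//.
- by rewrite -integral_mkcond integral_powR_tail// muleC.
- apply/(measurable_restrictT _ _).1 => //.
  by apply/measurable_EFinP/measurable_funTS; exact: measurable_powR.
- by move=> b _; rewrite patchE; case: ifPn => // _; rewrite lee_fin powR_ge0.
- by apply: integral_ge0 => x _; rewrite lee_fin mulr_ge0 ?expR_ge0.
Qed.
End Layer.

(** * Euler's integral *)

Lemma powRDgt0 (R : realType) (x r s : R) : 0 < x ->
  x `^ (r + s) = x `^ r * x `^ s.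
Proof. by move=> x0; rewrite powRD // (gt_eqF x0) implybT. Qed.

Lemma powR_sqr (R : realType) (x r : R) : 0 <= x ->
  (x ^+ 2) `^ r = (x `^ r) ^+ 2.
Proof.
by move=> x0; rewrite -powR_mulrn// -powRrM mulrC powRrM powR_mulrn// powR_ge0.
Qed.

Section EulerIntegral.
Context {R : realType}.
Notation mu := (@lebesgue_measure R).

(** Extended-real version of [Gamma]: the Tonelli arguments below apply before
    finiteness is known, and in fact they prove it. *)
Definition eGamma (z : R) : \bar R :=
  (\int[mu]_(t in `]0%R, +oo[) (t `^ (z - 1) * expR (- t))%:E)%E.

(** The density [t^(z-1)] cut to [t > 0], so that Euler's integral becomes one
    over the whole line. *)
Definition gamma_weight (z t : R) : R := t `^ (z - 1) * \1_(`]0, +oo[) t.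

Lemma gamma_weight_ge0 z t : 0 <= gamma_weight z t.
Proof. by rewrite mulr_ge0 ?powR_ge0. Qed.

Lemma gamma_weightE z t : 0 < t -> gamma_weight z t = t `^ (z - 1).
Proof.
by move=> t0; rewrite /gamma_weight indicE mem_set ?mulr1//= in_itv/= t0.
Qed.

Lemma gamma_weight_le0 z t : t <= 0 -> gamma_weight z t = 0.
Proof.
move=> t0; rewrite /gamma_weight indicE memNset ?mulr0//= in_itv/= andbT.
by apply/negP; rewrite -leNgt.
Qed.

Lemma measurable_gamma_weight z : measurable_fun setT (gamma_weight z).
Proof.
by apply: measurable_funM; [exact: measurable_powR|exact: measurable_indic].
Qed.

Lemma gamma_weight_mulr z t : gamma_weight z t * t = gamma_weight (z + 1) t.
Proof.
have [t0|t0] := leP t 0; first by rewrite !gamma_weight_le0// mul0r.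
rewrite !gamma_weightE// -[X in _ * X](powRr1 (ltW t0)) -powRDgt0//.
by congr (_ `^ _); ring.
Qed.

Lemma eGammaE z :
  eGamma z = (\int[mu]_t (gamma_weight z t * expR (- t))%:E)%E.
Proof.
rewrite /eGamma integral_mkcond; apply: eq_integral => t _.
rewrite patchE /gamma_weight indicE; case: ifPn => _.
  by rewrite mulr1.
by rewrite mulr0 mul0r.
Qed.

Lemma eGamma_ge0 z : (0 <= eGamma z)%E.
Proof.
by apply: integral_ge0 => t _; rewrite lee_fin mulr_ge0 ?expR_ge0// powR_ge0.
Qed.

Lemma integral_gamma_weight (z a : R) : 0 < a ->
  (\int[mu]_t (gamma_weight z t * expR (- (a * t)))%:E =
   (a `^ (- z))%:E * eGamma z)%E.
Proof.
move=> a0; rewrite eGammaE.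
have mw b : measurable_fun [set: R]
    (fun t => (gamma_weight z t * expR (- (b * t)))%:E).
  apply/measurable_EFinP; apply: measurable_funM.
    exact: measurable_gamma_weight.
  by apply: measurableT_comp => //; apply: measurableT_comp.
have mw1 : measurable_fun [set: R]
    (fun t => (gamma_weight z t * expR (- t))%:E).
  by have := mw 1; under eq_fun do rewrite mul1r.
have gwM t : gamma_weight z t = a `^ (1 - z) * gamma_weight z (a * t).
  have [t0|t0] := leP t 0.
    by rewrite !gamma_weight_le0 ?mulr0// pmulr_rle0.
  rewrite !gamma_weightE ?mulr_gt0// powRM ?ltW// mulrA -powRDgt0//.
  by rewrite (_ : 1 - z + (z - 1) = 0) ?powRr0 ?mul1r//; ring.
transitivity ((a `^ (1 - z))%:E *
    \int[mu]_t (gamma_weight z (a * t + 0) * expR (- (a * t + 0)))%:E)%E.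
  rewrite -ge0_integralZl//.
  - apply: eq_integral => t _.
    by rewrite addr0 -EFinM mulrA -gwM.
  - apply: (measurableT_comp mw1) => //.
    by apply: measurable_funD => //; exact: measurable_funM.
  - by move=> t _; rewrite lee_fin mulr_ge0 ?expR_ge0 ?gamma_weight_ge0.
  - by rewrite lee_fin powR_ge0.
rewrite (ge0_integral_affine 0 a0 mw1); last first.
  by move=> t; rewrite lee_fin mulr_ge0 ?expR_ge0 ?gamma_weight_ge0.
rewrite muleA -EFinM -(powR_inv1 (ltW a0)) -powRDgt0//.
by congr ((_ `^ _)%:E * _)%E; ring.
Qed.

(** [ge0_integral_expR_layer] with weight [t^(z-1)] and [phi t = t]; the
    homogeneity hypothesis is [integral_gamma_weight] at [z + 1]. *)
Lemma eGammaS z : 0 < z -> eGamma z = (z^-1%:E * eGamma (z + 1))%E.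
Proof.
move=> z0.
transitivity
    (z^-1%:E * \int[mu]_t (gamma_weight z t * t * expR (- t))%:E)%E; last first.
  by rewrite eGammaE; under eq_integral do rewrite gamma_weight_mulr.
rewrite eGammaE.
apply: (@ge0_integral_expR_layer _ _ _ mu _ (fun t => t)) => //.
- exact: measurable_gamma_weight.
- exact: gamma_weight_ge0.
- move=> t; rewrite ltNge; apply: contraNN => t0.
  by rewrite gamma_weight_le0.
- move=> b b1; under eq_integral do rewrite gamma_weight_mulr.
  under [in RHS]eq_integral do rewrite gamma_weight_mulr.
  rewrite integral_gamma_weight ?(lt_le_trans ltr01)// -eGammaE.
  by congr ((_ `^ _)%:E * _)%E; ring.
Qed.

Lemma eGamma1 : eGamma 1 = 1%E.
Proof.
rewrite /eGamma; under eq_integral do rewrite subrr powRr0 mul1r.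
rewrite integral_itv_obnd_cbnd; last first.
  by apply/measurable_EFinP/measurable_funTS; apply: measurableT_comp.
pose F (t : R) : R := - expR (- t).
transitivity ((0 - F 0)%:E); last by rewrite /F oppr0 expR0 opprK add0r.
apply: ge0_integral_ray; rewrite /F.
- by move=> t _; exact: expR_ge0.
- move=> t _; apply: continuous_comp; last exact: continuous_expR.
  by apply: continuousN.
- by move=> t _; apply: is_derive_eq; rewrite /GRing.scale/=; ring.
- by rewrite -oppr0; apply: cvgN; exact: cvgr_expR.
Qed.

Lemma eGamma_nat n : (eGamma n.+1%:R < +oo)%E.
Proof.
elim: n => [|n IH]; first by rewrite eGamma1 ltry.
have := @eGammaS n.+1%:R; rewrite ltr0Sn natr1 => /(_ isT) E.
have n0 : (0 < n.+1%:R :> R) by [].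
move: IH; rewrite E; case: (eGamma n.+2%:R) => [r _||//]; first exact: ltry.
by rewrite gt0_muley ?lte_fin ?invr_gt0.
Qed.

(** The functional equation gives the case of the positive integers from
    [eGamma1]; for [1 <= z <= N + 1] one has [t^(z-1) <= 1 + t^N]; one more step
    of the equation reaches [0 < z < 1]. *)
Lemma eGamma_lty z : 0 < z -> (eGamma z < +oo)%E.
Proof.
have ge1 y : 1 <= y -> (eGamma y < +oo)%E.
  move=> y1; have [N yN] : exists N, y <= N.+1%:R.
    by exists (Num.truncn y); exact/ltW/truncnS_gt.
  apply: (@le_lt_trans _ _ (eGamma 1 + eGamma N.+1%:R)%E); last first.
    by apply: lte_add_pinfty; [rewrite eGamma1 ltry|exact: eGamma_nat].
  have mg (p : R) : measurable_fun (`]0, +oo[%classic : set R)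
      (fun t : R => (t `^ p * expR (- t))%:E).
    apply/measurable_EFinP/measurable_funTS; apply: measurable_funM.
      exact: measurable_powR.
    by apply: measurableT_comp.
  have g0 (p t : R) : (0 <= (t `^ p * expR (- t))%:E)%E.
    by rewrite lee_fin mulr_ge0 ?powR_ge0 ?expR_ge0.
  rewrite /eGamma -ge0_integralD//; [|exact: mg|exact: mg].
  apply: ge0_le_integral => //; [exact: (mg (y - 1))| |].
    exact: emeasurable_funD (mg (1 - 1)) (mg (N.+1%:R - 1)).
  move=> t; rewrite /= in_itv/= andbT => t0.
  rewrite -EFinD lee_fin -mulrDl ler_pM2r ?expR_gt0//.
  rewrite subrr powRr0; have [t1|/ltW t1] := leP t 1.
    rewrite (@le_trans _ _ 1) ?lerDl ?powR_ge0//.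
    rewrite -[X in _ <= X](@powRr0 _ t); apply: ger_powR; first by rewrite t0.
    by rewrite subr_ge0.
  rewrite (@le_trans _ _ (t `^ (N.+1%:R - 1))) ?lerDr//.
  by apply: ler_powR; rewrite // lerD2r.
move=> z0; rewrite eGammaS//.
have := ge1 (z + 1); rewrite lerDr (ltW z0) => /(_ isT).
by move=> H; rewrite lte_mul_pinfty// lee_fin invr_ge0 ltW.
Qed.

(** On [1, 2] the integrand is at least [exp(-2) / 2], since [z - 1 >= -1]. *)
Lemma eGamma_gt0 z : 0 < z -> (0 < eGamma z)%E.
Proof.
move=> z0; apply: (@lt_le_trans _ _ (2^-1 * expR (- 2))%:E).
  by rewrite lte_fin mulr_gt0 ?invr_gt0 ?expR_gt0.
have mg : measurable_fun [set: R] (fun t : R => (t `^ (z - 1) * expR (- t))%:E).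
  apply/measurable_EFinP; apply: measurable_funM.
    exact: measurable_powR.
  by apply: measurableT_comp.
apply: (@le_trans _ _
  (\int[mu]_(t in `[1%R, 2%R]) (t `^ (z - 1) * expR (- t))%:E)%E).
  have : (\int[mu]_(t in `[1%R, 2%R]) (cst (2^-1 * expR (- 2))%:E) t =
      (2^-1 * expR (- 2))%:E)%E.
    rewrite integral_cst//= lebesgue_measure_itv/= lte_fin ltr1n.
    by rewrite -EFinB -EFinM; congr EFin; ring.
  move=> <-; apply: ge0_le_integral => //.
  - by move=> t _; rewrite lee_fin mulr_ge0 ?expR_ge0.
  - exact: measurable_funTS.
  - move=> t; rewrite /= in_itv/= => /andP[t1 t2].
    rewrite lee_fin ler_pM ?expR_ge0 ?ler_expR ?lerN2//.
    apply: (@le_trans _ _ (t `^ (-1))); last first.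
      by apply: ler_powR; rewrite // lerBDr addrC subrr ltW.
    rewrite powR_inv1 ?(le_trans ler01)//.
    by rewrite lef_pV2// posrE// (lt_le_trans ltr01).
apply: ge0_subset_integral => //.
- exact: measurable_funTS.
- by move=> t _; rewrite lee_fin mulr_ge0 ?powR_ge0 ?expR_ge0.
- move=> t; rewrite /= !in_itv/= andbT => /andP[t1 _].
  exact: lt_le_trans t1.
Qed.

Lemma eGamma_fin z : 0 < z -> eGamma z = (Gamma z)%:E.
Proof.
move=> z0; rewrite /Gamma /Rintegral fineK//.
by rewrite ge0_fin_numE ?eGamma_ge0// eGamma_lty.
Qed.

Lemma Gamma_gt0 (z : R) : 0 < z -> 0 < Gamma z.
Proof. by move=> z0; rewrite -lte_fin -eGamma_fin// eGamma_gt0. Qed.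

Lemma GammaS (z : R) : 0 < z -> Gamma (z + 1) = z * Gamma z.
Proof.
move=> z0; have := eGammaS z0.
rewrite !eGamma_fin ?addr_gt0// -EFinM => -[->].
by rewrite mulrA divff ?gt_eqF// mul1r.
Qed.

End EulerIntegral.

(** * Gaussian moments on the line *)

Section GaussianMoments.
Context {R : realType}.
Notation mu := (@lebesgue_measure R).

Lemma measurable_gauss_weight (p : R -> R) (a : R) : measurable_fun setT p ->
  measurable_fun [set: R] (fun t => (p t * expR (- (a * t ^+ 2)))%:E).
Proof.
move=> mp; apply/measurable_EFinP; apply: measurable_funM => //.
apply: measurableT_comp => //; apply: measurableT_comp => //.
by apply: measurable_funM => //; exact: measurable_funX.
Qed.

(** Substitution [t -> sqrt a * t] for a weight that is homogeneous of degree
    [m]. *)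
Lemma integral_gauss_scale (p : R -> R) (m a : R) : 0 < a ->
  measurable_fun setT p -> (forall t, 0 <= p t) ->
  (forall s t, 0 < s -> p (s * t) = s `^ m * p t) ->
  (\int[mu]_t (p t * expR (- (a * t ^+ 2)))%:E =
   (a `^ (- ((m + 1) / 2)))%:E * \int[mu]_t (p t * expR (- t ^+ 2))%:E)%E.
Proof.
move=> a0 mp p0 hom.
have s0 : 0 < a `^ (1 / 2) by rewrite powR_gt0.
have sq : (a `^ (1 / 2)) ^+ 2 = a.
  by rewrite -powR_mulrn ?powR_ge0// -powRrM divfK// powRr1 ?ltW.
have sm : a `^ (- (m / 2)) * (a `^ (1 / 2)) `^ m = 1.
  by rewrite -powRrM -powRDgt0// mul1r mulrC addNr powRr0.
have mg : measurable_fun [set: R] (fun t => (p t * expR (- t ^+ 2))%:E).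
  by have := measurable_gauss_weight 1 mp; under eq_fun do rewrite mul1r.
have pos t : (0 <= (p t * expR (- t ^+ 2))%:E)%E.
  by rewrite lee_fin mulr_ge0 ?expR_ge0.
transitivity ((a `^ (- (m / 2)))%:E * \int[mu]_t
   (p (a `^ (1 / 2) * t + 0) * expR (- (a `^ (1 / 2) * t + 0) ^+ 2))%:E)%E.
  rewrite -ge0_integralZl//.
  - apply: eq_integral => t _; rewrite addr0 hom// -EFinM exprMn sq.
    by congr EFin; rewrite -[p t in LHS]mul1r -[in LHS]sm; ring.
  - apply: (measurableT_comp mg) => //.
    by apply: measurable_funD => //; exact: measurable_funM.
  - by rewrite lee_fin powR_ge0.
rewrite (ge0_integral_affine 0 s0 mg pos) muleA -EFinM.
rewrite -powRN -powRDgt0//.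
by congr ((_ `^ _)%:E * _)%E; field.
Qed.

Lemma integral_gauss (a : R) : 0 < a ->
  (\int[mu]_t (expR (- (a * t ^+ 2)))%:E =
   (pi `^ (1 / 2) * a `^ (- (1 / 2)))%:E)%E.
Proof.
move=> a0; under eq_integral do rewrite -[expR _]mul1r.
rewrite (@integral_gauss_scale (cst 1) 0)//; last first.
  by move=> s t s0; rewrite powRr0 mulr1.
under eq_integral do rewrite mul1r.
rewrite integralT_gauss -EFinM mulrC add0r; congr (_ * _)%:E.
by rewrite div1r powR12_sqrt// pi_ge0.
Qed.

(** [ge0_integral_expR_layer] with [phi t = t^2], [z = 1/2] and the constant
    weight 1, removed at the origin where [phi] vanishes. *)
Lemma integral_sqr_gauss (a : R) : 0 < a ->
  (\int[mu]_t (t ^+ 2 * expR (- (a * t ^+ 2)))%:E =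
   (pi `^ (1 / 2) / 2 * a `^ (- (3 / 2)))%:E)%E.
Proof.
have msqr : measurable_fun [set: R] (fun t : R => t ^+ 2).
  exact: measurable_funX.
have hom (b : R) : 0 < b -> (\int[mu]_t (t ^+ 2 * expR (- (b * t ^+ 2)))%:E =
    (b `^ (- (3 / 2)))%:E * \int[mu]_t (t ^+ 2 * expR (- t ^+ 2))%:E)%E.
  move=> b0; rewrite (@integral_gauss_scale _ 2)//.
  - by congr ((_ `^ _)%:E * _)%E; ring.
  - by move=> t; exact: sqr_ge0.
- by move=> s t s0; rewrite exprMn powR_mulrn ?ltW.
move=> a0; rewrite hom// [X in _ = X%:E]mulrC EFinM; congr (_ * _)%E.
pose w (t : R) : R := \1_(~` [set 0]) t.
have mw : measurable_fun [set: R] w.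
  by apply: measurable_indic; exact: measurableC.
have wsq t : w t * t ^+ 2 = t ^+ 2.
  rewrite /w indicE; have [->|/eqP t0] := eqVneq t 0.
    by rewrite expr0n/= mulr0.
  by rewrite mem_set ?mul1r.
have H : (\int[mu]_t (w t * expR (- t ^+ 2))%:E =
    2%:E * \int[mu]_t (t ^+ 2 * expR (- t ^+ 2))%:E)%E.
  have := @ge0_integral_expR_layer _ _ _ mu w (fun t => t ^+ 2) (1 / 2).
  rewrite div1r invrK invr_gt0 ltr0n => /(_ isT mw msqr) ->.
  - by under eq_integral do rewrite wsq.
  - by move=> t; rewrite /w indicE.
  - move=> t wt0; rewrite exprn_even_gt0//=; apply: contraNN wt0.
    by move=> /eqP ->; rewrite /w indicE memNset//=; exact.
  - move=> b b1; under eq_integral do rewrite wsq.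
    under [in RHS]eq_integral do rewrite wsq.
    rewrite hom ?(lt_le_trans ltr01)//.
    by congr ((_ `^ _)%:E * _)%E; field.
have E : (\int[mu]_t (w t * expR (- t ^+ 2))%:E = (pi `^ (1 / 2))%:E)%E.
  rewrite div1r powR12_sqrt ?pi_ge0// -integralT_gauss.
  have m1 (p : R -> R) : measurable_fun [set: R] p ->
      measurable_fun [set: R] (fun t => (p t * expR (- t ^+ 2))%:E).
    by move=> /(measurable_gauss_weight 1); under eq_fun do rewrite mul1r.
  apply: ge0_ae_eq_integral => //.
  - exact: m1.
  - by apply/measurable_EFinP; exact: measurable_gauss_fun.
  - by move=> t _; rewrite lee_fin mulr_ge0 ?expR_ge0// /w indicE.
  - by move=> t _; rewrite lee_fin gauss_fun_ge0.
  - exists [set 0]; split; [by []|exact: lebesgue_measure_set1|].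
    move=> t /= h; apply: contrapT => t0; apply: h => _.
    by rewrite /w indicE mem_set ?mul1r.
move: E; rewrite H; case: (\int[mu]_t _)%E => [r| |].
- by rewrite -EFinM => -[<-]; congr EFin; field.
- by rewrite gt0_muley// lte_fin.
- by rewrite gt0_muleNy// lte_fin.
Qed.

End GaussianMoments.

(** * Iterated integrals over R^d *)

Section LebesgueTupleIntegral.
Context {R : realType}.
Notation mu := (@lebesgue_measure R).
Notation lam d := (lebesgue_tuple R d).
Notation pts d := (d.-tuple (measurableTypeR R)).

Lemma integral_lebesgue_tuple0 (F : pts 0 -> \bar R) :
  (\int[lam 0]_y F y = F [tuple])%E.
Proof.
rewrite /= integral_dirac//.
  by rewrite diracT mul1e.
rewrite (_ : F = cst (F [tuple])) //.
by apply/funext => y; rewrite tuple0.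
Qed.

(** Tonelli's theorem for one coordinate; the recursion behind all other facts
    on the measure of R^d. *)
Lemma ge0_integral_lebesgue_tupleS d (F : pts d.+1 -> \bar R) :
  measurable_fun setT F -> (forall y, (0 <= F y)%E) ->
  (\int[lam d.+1]_y F y =
   \int[mu]_a \int[lam d]_t F (tuple_cons (a, t)))%E.
Proof.
move=> mF F0.
have mc := @measurable_tuple_cons R d.
rewrite /= /lebesgue_cons (ge0_integral_pushforward mc)//.
rewrite preimage_setT (fubini_tonelli1 (F \o @tuple_cons R d))//.
  exact: measurableT_comp.
by move=> p; exact: F0.
Qed.

Lemma measurable_tuple_map d (phi : 'I_d -> R -> R) :
  (forall i, measurable_fun setT (phi i)) ->
  measurable_fun setT
    (fun y : pts d => [tuple (phi i (tnth y i) : measurableTypeR R) | i < d]).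
Proof.
move=> mphi; apply/measurable_fun_tnthP => i.
rewrite (_ : _ \o _ = fun y : pts d => phi i (tnth y i)); last first.
  by apply/funext => y /=; rewrite tnth_mktuple.
by apply: (measurableT_comp (mphi i)); exact: measurable_tnth.
Qed.

(** Covers at once the translations, used to move [x] above the origin, and
    the reflections, used for orthogonality. *)
Lemma ge0_integral_tuple_map d (phi : 'I_d -> R -> R) (F : pts d -> \bar R) :
  (forall i, measurable_fun setT (phi i)) ->
  (forall i (g : R -> \bar R), measurable_fun setT g ->
    (forall t, (0 <= g t)%E) -> \int[mu]_t g (phi i t) = \int[mu]_t g t)%E ->
  measurable_fun setT F -> (forall y, (0 <= F y)%E) ->
  (\int[lam d]_y F [tuple (phi i (tnth y i) : measurableTypeR R) | i < d] =
   \int[lam d]_y F y)%E.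
Proof.
elim: d phi F => [|d IH] phi F mphi inv mF F0.
  by rewrite !integral_lebesgue_tuple0 (tuple0 [tuple _ | _ < _]).
rewrite ge0_integral_lebesgue_tupleS//; last first.
  by apply: measurableT_comp => //; exact: measurable_tuple_map.
rewrite ge0_integral_lebesgue_tupleS//.
pose phi' (i : 'I_d) := phi (lift ord0 i).
have mFc (a : R) : measurable_fun setT (fun t : pts d => F (tuple_cons (a, t))).
  apply: measurableT_comp => //.
  by apply: (measurableT_comp (@measurable_tuple_cons R d)).
have mapE (a : R) (t : pts d) :
    [tuple (phi i (tnth (tuple_cons (a, t)) i) : measurableTypeR R)
      | i < d.+1] =
    tuple_cons (phi ord0 a : measurableTypeR R,
      [tuple (phi' i (tnth t i) : measurableTypeR R) | i < d]).
  apply: eq_from_tnth => i; rewrite tnth_mktuple.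
  by case: (unliftP ord0 i) => [j ->|->]; rewrite ?tnthS ?tnth_mktuple.
under eq_integral => a _.
  under eq_integral do rewrite mapE.
  rewrite (IH phi' (fun t => F (tuple_cons (phi ord0 a, t))) (fun i => mphi _)
    (fun i => inv _) (mFc _) (fun t => F0 _)).
  over.
apply: (inv ord0 (fun a => \int[lam d]_t F (tuple_cons (a, t)))%E).
- apply: (measurable_fun_fubini_tonelli_F (F \o @tuple_cons R d)).
  by apply: measurableT_comp => //; exact: measurable_tuple_cons.
  by move=> p; exact: F0.
- by move=> a; apply: integral_ge0 => t _; exact: F0.
Qed.

Lemma ge0_integral_tuple_prod d (g : 'I_d -> R -> R) :
  (forall i, measurable_fun setT (g i)) -> (forall i t, 0 <= g i t) ->
  (\int[lam d]_y (\prod_(i < d) g i (tnth y i))%:E =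
   \prod_(i < d) \int[mu]_t (g i t)%:E)%E.
Proof.
elim: d g => [|d IH] g mg g0.
  by rewrite integral_lebesgue_tuple0 !big_ord0.
have mP n (h : 'I_n -> R -> R) : (forall i, measurable_fun setT (h i)) ->
    measurable_fun setT (fun y : pts n => (\prod_(i < n) h i (tnth y i))%:E).
  move=> mh; apply/measurable_EFinP; apply: measurable_prod => i _.
  by apply: (measurableT_comp (mh i)); exact: measurable_tnth.
rewrite ge0_integral_lebesgue_tupleS//; [|exact: mP|]; last first.
  by move=> y; rewrite lee_fin prodr_ge0.
pose g' (i : 'I_d) := g (lift ord0 i).
have slice (a : R) : (\int[lam d]_t
      (\prod_(i < d.+1) g i (tnth (tuple_cons (a, t)) i))%:E =
    (g ord0 a)%:E * \prod_(i < d) \int[mu]_t (g' i t)%:E)%E.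
  rewrite -(IH g' (fun i => mg _) (fun i => g0 _)) -ge0_integralZl//.
  - apply: eq_integral => t _; rewrite big_ord_recl -EFinM; congr (_ * _)%:E.
    by apply: eq_bigr => i _; rewrite tnthS.
  - exact: (mP d g' (fun i => mg _)).
  - by move=> y _; rewrite lee_fin prodr_ge0// => i _; exact: g0.
  - by rewrite lee_fin.
under eq_integral do rewrite slice.
rewrite ge0_integralZr//.
- by rewrite big_ord_recl.
- by apply/measurable_EFinP; exact: mg.
- by move=> t _; rewrite lee_fin.
- apply: prode_ge0 => i _; apply: integral_ge0 => t _; rewrite lee_fin.
  exact: g0.
Qed.

End LebesgueTupleIntegral.

(** * Integrals of powers of [|y|^2 + a] *)

Section PoissonTypeIntegrals.
Context {R : realType}.
Notation mu := (@lebesgue_measure R).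
Notation lam d := (lebesgue_tuple R d).
Notation pts d := (d.-tuple (measurableTypeR R)).

Definition sqnorm d (y : pts d) : R := \sum_(i < d) (tnth y i : R) ^+ 2.

Lemma sqnorm_ge0 d (y : pts d) : 0 <= sqnorm y.
Proof. by apply: sumr_ge0 => i _; exact: sqr_ge0. Qed.

Lemma measurable_coord d (i : 'I_d) :
  measurable_fun setT (fun y : pts d => tnth y i : R).
Proof. exact: measurable_tnth. Qed.

Lemma measurable_sqnorm d : measurable_fun setT (@sqnorm d).
Proof.
apply: measurable_sum => i; apply: measurable_funX; exact: measurable_coord.
Qed.

Lemma integral_tuple_gauss d (t : R) : 0 < t ->
  (\int[lam d]_y (expR (- (t * sqnorm y)))%:E =
   (pi `^ (d%:R / 2) * t `^ (- (d%:R / 2)))%:E)%E.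
Proof.
move=> t0.
under eq_integral do rewrite /sqnorm mulr_sumr -sumrN expR_sum.
rewrite (@ge0_integral_tuple_prod _ d (fun _ u => expR (- (t * u ^+ 2))))//.
- under eq_bigr do rewrite integral_gauss//.
  rewrite prodEFin prodr_const card_ord exprMn -!powR_mulrn ?powR_ge0//.
  rewrite -!powRrM; congr (_ `^ _ * _ `^ _)%:E; ring.
- move=> i; apply: measurableT_comp => //; apply: measurableT_comp => //.
  by apply: measurable_funM => //; exact: measurable_funX.
Qed.

Lemma integral_tuple_sqr_gauss d (i : 'I_d) (t : R) : 0 < t ->
  (\int[lam d]_y ((tnth y i : R) ^+ 2 * expR (- (t * sqnorm y)))%:E =
   (pi `^ (d%:R / 2) / 2 * t `^ (- (d%:R / 2 + 1)))%:E)%E.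
Proof.
move=> t0; pose p (j : 'I_d) (u : R) : R := if j == i then u ^+ 2 else 1.
pose g j u := p j u * expR (- (t * u ^+ 2)).
have gE y : (tnth y i : R) ^+ 2 * expR (- (t * sqnorm y)) =
    \prod_(j < d) g j (tnth y j).
  rewrite /g big_split/= /sqnorm mulr_sumr -sumrN expR_sum; congr (_ * _).
  rewrite (bigD1 i)//= /p eqxx big1 ?mulr1// => j /negbTE ->.
  by [].
under eq_integral do rewrite gE.
have mp j : measurable_fun setT (p j).
  by rewrite /p; case: (j == i) => //; exact: measurable_funX.
have p0 j u : 0 <= p j u by rewrite /p; case: ifP => // _; exact: sqr_ge0.
rewrite ge0_integral_tuple_prod; last 2 first.
- move=> j; apply: measurable_funM => //.
  apply: measurableT_comp => //; apply: measurableT_comp => //.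
  by apply: measurable_funM => //; exact: measurable_funX.
- by move=> j u; rewrite mulr_ge0 ?expR_ge0.
rewrite (bigD1 i)//=.
under eq_integral do rewrite /g /p eqxx.
rewrite integral_sqr_gauss//.
rewrite (eq_bigr (fun=> (pi `^ (1 / 2) * t `^ (- (1 / 2)))%:E)); last first.
  move=> j /negbTE ji; rewrite -integral_gauss//.
  by apply: eq_integral => u _; rewrite /g /p ji mul1r.
rewrite prodEFin -EFinM.
rewrite prodr_const.
have -> : #|(fun j : 'I_d => j != i)| = d.-1.
  by have := cardC1 i; rewrite card_ord.
have dE : d%:R = d.-1%:R + 1 :> R.
  by rewrite natr1 prednK// (leq_ltn_trans _ (ltn_ord i)).
rewrite exprMn -!powR_mulrn ?powR_ge0// -!powRrM.
have pi0 : 0 < pi :> R by exact: pi_gt0.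
congr EFin; rewrite mulrACA; congr (_ * _).
  rewrite mulrAC -powRDgt0//; congr (_ `^ _ / _).
  by rewrite dE; ring.
by rewrite -powRDgt0//; congr (_ `^ _); rewrite dE; field.
Qed.

(** Write [Gamma s * (|y|^2 + a)^(-s)] as the integral over [t > 0] of
    [t^(s-1) exp(- t (|y|^2 + a))] and integrate in [y] first.  The Gaussian
    moment [c t^(-m)] of the weight [q] lowers the exponent to [s - m - 1],
    which leaves Euler's integral at [s - m] with the rate [a]. *)
Lemma subordination d (q : pts d -> R) (c m s a : R) :
  0 < s -> 0 < s - m -> 0 < a -> 0 <= c ->
  measurable_fun setT q -> (forall y, 0 <= q y) ->
  (forall t : R, (0 < t)%R ->
    \int[lam d]_y (q y * expR (- (t * sqnorm y)))%:E = (c * t `^ (- m))%:E)%E ->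
  (\int[lam d]_y (q y * (sqnorm y + a) `^ (- s))%:E =
   (c * Gamma (s - m) / Gamma s * a `^ (m - s))%:E)%E.
Proof.
move=> s0 sm0 a0 c0 mq q0 gaussq.
have rho0 (y : pts d) : 0 < sqnorm y + a by rewrite ltr_wpDl ?sqnorm_ge0.
have mrho : measurable_fun setT (fun y : pts d => sqnorm y + a).
  by apply: measurable_funD => //; exact: measurable_sqnorm.
(* Naming the values keeps Euler's integral out of the unification problems. *)
have [Gs0 GsE] := (Gamma_gt0 s0, eGamma_fin s0).
move: (Gamma s) Gs0 GsE => Gs Gs0 GsE.
have GmE := eGamma_fin sm0; move: (Gamma (s - m)) GmE => Gm GmE.
pose F (p : pts d * measurableTypeR R) : \bar R :=
  (q p.1 * (gamma_weight s p.2 * expR (- ((sqnorm p.1 + a) * p.2))))%:E.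
have mF : measurable_fun setT F.
  apply/measurable_EFinP; apply: measurable_funM.
    exact: measurableT_comp.
  apply: measurable_funM.
    by apply: measurableT_comp => //; exact: measurable_gamma_weight.
  apply: measurableT_comp => //; apply: measurableT_comp => //.
  apply: measurable_funM => //.
  exact: (measurableT_comp mrho).
have F0 p : (0 <= F p)%E.
  by rewrite lee_fin mulr_ge0// mulr_ge0 ?expR_ge0// gamma_weight_ge0.
have mexp (b : R) : measurable_fun [set: R]
    (fun t => (gamma_weight s t * expR (- (b * t)))%:E).
  apply/measurable_EFinP; apply: measurable_funM.
    exact: measurable_gamma_weight.
  by apply: measurableT_comp => //; apply: measurableT_comp.
have F1 y : (\int[mu]_t F (y, t) =
    Gs%:E * (q y * (sqnorm y + a) `^ (- s))%:E)%E.
  rewrite /F/=; under eq_integral do rewrite EFinM.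
  rewrite ge0_integralZl//.
  - by rewrite integral_gamma_weight// GsE -!EFinM; congr EFin; ring.
  - exact: mexp.
  - by move=> t _; rewrite lee_fin mulr_ge0 ?expR_ge0 ?gamma_weight_ge0.
  - by rewrite lee_fin.
have F2 t : (\int[lam d]_y F (y, t) =
    c%:E * (gamma_weight (s - m) t * expR (- (a * t)))%:E)%E.
  rewrite /F/=; have [t0|t0] := leP t 0.
    rewrite (gamma_weight_le0 (s - m))// mul0r mule0.
    by apply: integral0_eq => y _; rewrite gamma_weight_le0// mul0r mulr0.
  transitivity ((gamma_weight s t * expR (- (a * t)))%:E *
      \int[lam d]_y (q y * expR (- (t * sqnorm y)))%:E)%E.
    rewrite -ge0_integralZl//.
    - apply: eq_integral => y _; rewrite -EFinM; congr EFin.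
      rewrite mulrDl opprD expRD [sqnorm y * t]mulrC; ring.
    - apply/measurable_EFinP; apply: measurable_funM => //.
      apply: measurableT_comp => //; apply: measurableT_comp => //.
      by apply: measurable_funM => //; exact: measurable_sqnorm.
    - by move=> y _; rewrite lee_fin mulr_ge0 ?expR_ge0.
    - by rewrite lee_fin mulr_ge0 ?expR_ge0 ?gamma_weight_ge0.
  rewrite gaussq// -!EFinM !gamma_weightE//; congr EFin.
  rewrite (_ : s - m - 1 = (s - 1) + (- m)); last by ring.
  rewrite (powRDgt0 (s - 1) (- m))//; ring.
have key : (Gs%:E * \int[lam d]_y (q y * (sqnorm y + a) `^ (- s))%:E =
    (c * Gm * a `^ (m - s))%:E)%E.
  rewrite -ge0_integralZl//.
  - under eq_integral do rewrite -F1.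
    rewrite fubini_tonelli//; under eq_integral do rewrite F2.
    rewrite ge0_integralZl//.
    + rewrite integral_gamma_weight// GmE -!EFinM opprB.
      by congr EFin; ring.
    + apply/measurable_EFinP; apply: measurable_funM.
        exact: measurable_gamma_weight.
      by apply: measurableT_comp => //; apply: measurableT_comp.
    + by move=> t _; rewrite lee_fin mulr_ge0 ?expR_ge0 ?gamma_weight_ge0.
  - apply/measurable_EFinP; apply: measurable_funM => //.
    exact: (measurableT_comp (measurable_powR (- s)) mrho).
  - by move=> y _; rewrite lee_fin mulr_ge0 ?powR_ge0.
  - by rewrite lee_fin ltW.
have := congr1 (fun e => Gs^-1%:E * e)%E key.
rewrite muleA -!EFinM mulVf ?gt_eqF// mul1e => ->; congr EFin; ring.
Qed.

Lemma integral_tuple_powR d (s a : R) : 0 < s -> d%:R / 2 < s -> 0 < a ->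
  (\int[lam d]_y ((sqnorm y + a) `^ (- s))%:E =
   (pi `^ (d%:R / 2) * Gamma (s - d%:R / 2) / Gamma s *
     a `^ (d%:R / 2 - s))%:E)%E.
Proof.
move=> s0 ds a0; rewrite -(@subordination d (cst 1))//.
- by under [RHS]eq_integral do rewrite mul1r.
- by rewrite subr_gt0.
- by rewrite powR_ge0.
- move=> t t0; under eq_integral do rewrite mul1r.
  exact: integral_tuple_gauss.
Qed.

Lemma integral_tuple_sqr_powR d (i : 'I_d) (s a : R) :
  d%:R / 2 + 1 < s -> 0 < a ->
  (\int[lam d]_y ((tnth y i : R) ^+ 2 * (sqnorm y + a) `^ (- s))%:E =
   (pi `^ (d%:R / 2) / 2 * Gamma (s - (d%:R / 2 + 1)) / Gamma s *
     a `^ (d%:R / 2 + 1 - s))%:E)%E.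
Proof.
move=> ds a0; rewrite -(@subordination d (fun y => (tnth y i : R) ^+ 2))//.
- by rewrite (lt_trans _ ds)// ltr_wpDl ?divr_ge0.
- by rewrite subr_gt0.
- by rewrite divr_ge0 ?powR_ge0.
- by apply: measurable_funX; exact: measurable_coord.
- by move=> y; exact: sqr_ge0.
- by move=> t t0; exact: integral_tuple_sqr_gauss.
Qed.

End PoissonTypeIntegrals.

(** * Bessel's inequality in L^2 *)

Section SquareIntegrable.
Context {R : realType} d (T : measurableType d) (m : {measure set T -> \bar R}).

Lemma abse_poweR2 (r : R) : (`|r%:E| `^ 2 = (r ^+ 2)%:E)%E.
Proof.
by rewrite abse_EFin poweR_EFin powR_mulrn// -normrX ger0_norm// sqr_ge0.
Qed.

Lemma integrable_sqr_Lfun2 (f : T -> R) : measurable_fun setT f ->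
  m.-integrable setT (EFin \o (fun x => f x ^+ 2)) -> f \in Lfun m 2%:E.
Proof.
move=> mf /integrableP[_ fin]; rewrite inE; apply/andP; split; rewrite inE//=.
rewrite /finite_norm unlock poweR_lty//; apply: le_lt_trans fin.
rewrite le_eqVlt; apply/orP; left; apply/eqP; apply: eq_integral => x _.
by rewrite abse_poweR2 gee0_abs// lee_fin sqr_ge0.
Qed.

Lemma Lfun2_integrable_mul (f g : T -> R) :
  f \in Lfun m 2%:E -> g \in Lfun m 2%:E ->
  m.-integrable setT (EFin \o (fun x => f x * g x)).
Proof. by move=> lf lg; apply/Lfun1_integrable; exact: Lfun2_mul_Lfun1. Qed.

Lemma Lnorm2_sqr (f : T -> R) :
  (fine 'N[m]_(2%:E)[EFin \o f]%E) ^+ 2 = \int[m]_x (f x ^+ 2).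
Proof.
rewrite -powR_mulrn ?fine_ge0 ?Lnorm_ge0// -fine_poweR.
rewrite poweR_Lnorm// /Rintegral; congr fine.
by apply: eq_integral => x _; rewrite abse_poweR2.
Qed.

Lemma integrable_sumZ (I : Type) (s : seq I) (a : I -> R) (F : I -> T -> R) :
  (forall i, m.-integrable setT (EFin \o F i)) ->
  m.-integrable setT (EFin \o (fun x => \sum_(i <- s) a i * F i x)).
Proof.
move=> iF.
rewrite (_ : _ \o _ = fun x => \sum_(i <- s) (a i)%:E * (F i x)%:E)%E.
  by apply: integrable_sum => // i _; apply: integrableZl => //; exact: iF.
by apply/funext => x /=; rewrite sumEFin.
Qed.

Lemma Rintegral_sumZ (I : Type) (s : seq I) (a : I -> R) (F : I -> T -> R) :
  (forall i, m.-integrable setT (EFin \o F i)) ->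
  \int[m]_x (\sum_(i <- s) a i * F i x) = \sum_(i <- s) a i * \int[m]_x F i x.
Proof.
move=> iF; elim: s => [|i s IH].
  rewrite big_nil; under eq_Rintegral do rewrite big_nil.
  by rewrite /Rintegral integral0.
under eq_Rintegral do rewrite big_cons.
rewrite RintegralD//; last 2 first.
- exact: (integrableZl _ (a i) (iF i)).
- exact: integrable_sumZ.
by rewrite RintegralZl// big_cons IH.
Qed.

(** The usual proof expands the square of the distance from [f] to its
    projection.  Taking the coefficients [c_i / M] instead of [c_i / ||g_i||^2]
    treats all the [g_i] alike, including those that may vanish. *)
Lemma bessel (n : nat) (g : 'I_n -> T -> R) (M : R) (f : T -> R) : 0 < M ->
  (forall i, g i \in Lfun m 2%:E) ->
  (forall i j, i != j -> \int[m]_x (g i x * g j x) = 0) ->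
  (forall i, \int[m]_x (g i x * g i x) <= M) ->
  f \in Lfun m 2%:E ->
  \sum_(i < n) (\int[m]_x (g i x * f x)) ^+ 2 <= M * \int[m]_x (f x ^+ 2).
Proof.
move=> M0 lg orth gM lf.
pose c i := \int[m]_x (g i x * f x).
pose S := \sum_(i < n) c i ^+ 2.
pose A x := \sum_(i < n) (2 * (c i / M)) * (g i x * f x).
pose B x := \sum_(p : 'I_n * 'I_n)
  (c p.1 / M * (c p.2 / M)) * (g p.1 x * g p.2 x).
have igf i : m.-integrable setT (EFin \o (fun x => g i x * f x)).
  exact: Lfun2_integrable_mul.
have igg (p : 'I_n * 'I_n) :
    m.-integrable setT (EFin \o (fun x => g p.1 x * g p.2 x)).
  exact: Lfun2_integrable_mul.
have iff := Lfun2_integrable_sqr lf.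
have iA : m.-integrable setT (EFin \o A).
  by apply: (integrable_sumZ _ _ igf).
have iB : m.-integrable setT (EFin \o B).
  by apply: (integrable_sumZ _ _ igg).
have sqE x : (f x - \sum_(i < n) c i / M * g i x) ^+ 2 = f x ^+ 2 - A x + B x.
  rewrite sqrrB; congr (_ - _ + _).
    rewrite /A mulr_sumr -sumrMnl; apply: eq_bigr => i _; ring.
  rewrite expr2 big_distrlr /B (pair_bigA _ (fun i j => _))/=.
  by apply: eq_bigr => -[i j] _ /=; ring.
have : 0 <= \int[m]_x ((f x - \sum_(i < n) c i / M * g i x) ^+ 2).
  by apply: Rintegral_ge0 => x _; exact: sqr_ge0.
under eq_Rintegral do rewrite sqE.
rewrite RintegralD//; last exact: (integrableB _ iff iA).
rewrite RintegralB//.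
have -> : \int[m]_x A x = 2 * S / M.
  rewrite (Rintegral_sumZ _ _ igf) /S mulr_sumr mulr_suml.
  by apply: eq_bigr => i _; rewrite -/(c i); ring.
have : \int[m]_x B x <= S / M.
  rewrite (Rintegral_sumZ _ _ igg).
  rewrite -(pair_bigA _ (fun i j => c i / M * (c j / M) *
    \int[m]_x (g i x * g j x)))/= /S mulr_suml.
  apply: ler_sum => i _; rewrite (bigD1 i)//= big1 ?addr0; last first.
    by move=> j ji; rewrite orth ?mulr0// eq_sym.
  rewrite (_ : c i ^+ 2 / M = c i / M * (c i / M) * M); last first.
    by field; rewrite gt_eqF.
  by apply: ler_wpM2l => //; rewrite -expr2 sqr_ge0.
move=> BS H; rewrite -/S mulrC -ler_pdivrMr//.
have -> : S / M = 2 * S / M - S / M by ring.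
lra.
Qed.

End SquareIntegrable.

(** * Differentiation under the integral sign *)

Section DifferentiationUnderIntegral.
Context {R : realType}.

Section LinearForm.
Context (n : nat) (w : 'I_n -> R).

(** Bundled as a linear map, as the uniqueness of the differential requires. *)
Definition dot_form (v : 'rV[R]_n) : R := \sum_(i < n) v 0 i * w i.

Lemma dot_form_is_linear : linear dot_form.
Proof.
move=> a u v; rewrite /dot_form /GRing.scale/= mulr_sumr -big_split/=.
by apply: eq_bigr => i _; rewrite !mxE mulrDl mulrA.
Qed.

HB.instance Definition _ :=
  GRing.isLinear.Build R 'rV[R]_n R *:%R dot_form dot_form_is_linear.

Lemma dot_form_delta i : dot_form (delta_mx 0 i) = w i.
Proof.
rewrite /dot_form (bigD1 i)//= mxE !eqxx mul1r big1 ?addr0// => j ji.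
by rewrite mxE eqxx (negbTE ji) mul0r.
Qed.

End LinearForm.

Lemma continuous_dot_form n (w : 'I_n.+1 -> R) : continuous (dot_form w).
Proof.
apply: (@continuous_big _ _ _ _ _ _) => [|i _ v].
  by move=> z; exact: add_continuous.
by apply: continuousM;
  [exact: coord_continuous|exact: cst_continuous].
Qed.

Lemma differentiable_dot_form n (u : 'rV[R]_n.+1 -> R) (x : 'rV[R]_n.+1)
    (w : 'I_n.+1 -> R) :
  (forall e, 0 < e -> \forall v \near (0 : 'rV[R]_n.+1),
     `|u (v + x) - u x - dot_form w v| <= e * `|v|) ->
  differentiable u x /\ (forall i, partial i u x = w i).
Proof.
move=> H.
have E : (u \o shift x : 'rV[R]_n.+1 -> R^o) =
    cst (u x) + (dot_form w : 'rV[R]_n.+1 -> R^o) +o_ (0 : 'rV[R]_n.+1) id.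
  apply/(@eqaddoP R _ R 'rV[R]_n.+1 (nbhs_filter_on (0 : 'rV[R]_n.+1))
    (u \o shift x) (cst (u x) + dot_form w) id) => e e0.
  move: (H e e0); apply: filterS => v /=.
  by rewrite -[(_ - _) v]/(u (v + x) - (u x + dot_form w v)) opprD addrA.
pose L : {linear 'rV[R]_n.+1 -> R^o} := dot_form w.
have dE := @diff_unique R _ R^o u L x (@continuous_dot_form n w) E.
have du : differentiable u x.
  by apply/diff_locallyP; rewrite dE; split => //; exact: continuous_dot_form.
by split=> // i; rewrite /partial deriveE// dE -(dot_form_delta w i).
Qed.

(** A Frechet-type expansion of the integrand whose remainder is dominated by
    [e |v| W y], uniformly in [y], can be integrated term by term. *)
Lemma differentiable_integral d (T : measurableType d)
    (m : {measure set T -> \bar R}) n (K : 'rV[R]_n.+1 -> T -> R)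
    (G : 'I_n.+1 -> T -> R) (W : T -> R) (x : 'rV[R]_n.+1) :
  (\forall v \near (0 : 'rV[R]_n.+1), m.-integrable setT (EFin \o K (v + x))) ->
  (forall i, m.-integrable setT (EFin \o G i)) ->
  m.-integrable setT (EFin \o W) ->
  (forall e, 0 < e -> \forall v \near (0 : 'rV[R]_n.+1), forall y,
     `|K (v + x) y - K x y - \sum_(i < n.+1) v 0 i * G i y|
       <= e * `|v| * W y) ->
  let u z := \int[m]_y K z y in
  differentiable u x /\ (forall i, partial i u x = \int[m]_y G i y).
Proof.
move=> iK iG iW HK u.
apply: differentiable_dot_form => e e0.
pose I := \int[m]_y W y.
have I0 : 0 < `|I| + 1 by rewrite ltr_wpDl.
have iKx : m.-integrable setT (EFin \o K x).
  by have /nbhs_singleton := iK; rewrite add0r.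
near=> v.
have iKv : m.-integrable setT (EFin \o K (v + x)).
  by near: v; exact: iK.
have Kv : forall y, `|K (v + x) y - K x y - \sum_(i < n.+1) v 0 i * G i y|
    <= e / (`|I| + 1) * `|v| * W y.
  by near: v; apply: HK; rewrite divr_gt0.
have iS := @integrable_sumZ R _ _ m _ (index_enum 'I_n.+1) (v 0) G iG.
rewrite /u /dot_form -(Rintegral_sumZ _ _ iG).
rewrite -RintegralB// -RintegralB//; last first.
  exact: (integrableB _ iKv iKx).
have iD := integrableB measurableT (integrableB measurableT iKv iKx) iS.
apply: le_trans (le_normr_Rintegral measurableT iD) _.
apply: (@le_trans _ _ (\int[m]_y (e / (`|I| + 1) * `|v| * W y))).
  apply: le_Rintegral => //.
  - exact: (integrable_norm iD).
  - exact: (integrableZl _ _ iW).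
rewrite RintegralZl// -/I.
apply: (@le_trans _ _ (e / (`|I| + 1) * `|v| * (`|I| + 1))).
  apply: ler_wpM2l; first by rewrite mulr_ge0// divr_ge0// ltW.
  by rewrite (le_trans (ler_norm I))// lerDl.
by rewrite mulrAC divfK ?gt_eqF.
Unshelve. all: by end_near. Qed.

Lemma powR_first_order (p e : R) : 0 < e ->
  exists2 h, 0 < h & forall t, `|t - 1| < h ->
    `|t `^ p - 1 - p * (t - 1)| <= e * `|t - 1|.
Proof.
move=> e0; have D := @is_derive1_powR R p 1 ltr01.
have /derivable1_diffP dp : derivable (fun t : R => t `^ p) 1 1 by case: D.
have := diff_locally dp => /eqaddoP /(_ e e0) /nbhs_ballP[h /= h0 H].
exists h => // t th; have := H (t - 1).
rewrite -ball_normE /ball_/= sub0r normrN => /(_ th).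
suff dE : 'd (@powR R ^~ p) (1 : R) (t - 1) = p * (t - 1).
  rewrite -[(_ - _) (t - 1)]/((t - 1 + 1) `^ p -
    (1 `^ p + 'd (@powR R ^~ p) (1 : R) (t - 1))).
  by rewrite subrK powR1 dE opprD addrA.
rewrite diff1E// /GRing.scale/= mulrC; congr (_ * _).
by rewrite derive1E derive_val powR1 mulr1.
Qed.

(** Stated with a parameter [r] that controls both arguments, so that it
    applies with the same [h] to all values of [t] and [s] that depend on the
    variable of integration. *)
Lemma powR_mul_first_order (p q e C : R) : 0 < e -> 0 <= C ->
  exists2 h, 0 < h & forall t s r, 0 <= r -> r < h ->
    `|t - 1| <= C * r -> `|s - 1| <= C * r ->
    `|t `^ p * s `^ q - 1 - p * (t - 1) - q * (s - 1)| <= e * r.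
Proof.
(* Three error terms: those of the two factors, each at most [e1 * (C * r)],
   and the product of the increments, which is of order [r ^ 2]. *)
move=> e0 C0; pose e1 := e / (4 * (C + 1)).
have C1 : 0 < 4 * (C + 1) by rewrite mulr_gt0// ltr_wpDl.
have e10 : 0 < e1 by rewrite divr_gt0.
have e1C : e1 * C <= e / 4.
  rewrite /e1 mulrAC ler_pdivrMr// (_ : e / 4 * (4 * (C + 1)) = e * C + e).
    by rewrite lerDl ltW.
  by field.
have [h1 h10 H1] := powR_first_order p e10.
have [h2 h20 H2] := powR_first_order q e10.
pose P := (`|p| + e1) * (`|q| + e1) * C ^+ 2.
have P0 : 0 <= P by rewrite mulr_ge0 ?sqr_ge0// mulr_ge0// addr_ge0// ltW.
have P1 : 0 < 4 * (P + 1) by rewrite mulr_gt0// ltr_wpDl.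
have C2 : 0 < C + 1 by rewrite ltr_wpDl.
exists (Num.min (h1 / (C + 1)) (Num.min (h2 / (C + 1)) (e / (4 * (P + 1))))).
  by rewrite !lt_min !divr_gt0.
move=> t s r r0; rewrite !lt_min => /and3P[rh1 rh2 re] tC sC.
have Cr h : r < h / (C + 1) -> C * r < h.
  rewrite ltr_pdivlMr// => rh; apply: le_lt_trans rh.
  by rewrite mulrC ler_wpM2l// lerDl.
have t1 := H1 t (le_lt_trans tC (Cr _ rh1)).
have s1 := H2 s (le_lt_trans sC (Cr _ rh2)).
have crude (c u y : R) : `|y - 1 - c * (u - 1)| <= e1 * `|u - 1| ->
    `|u - 1| <= C * r -> `|y - 1| <= (`|c| + e1) * (C * r).
  move=> yc uC; apply: (@le_trans _ _ ((`|c| + e1) * `|u - 1|)); last first.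
    by rewrite ler_wpM2l// addr_ge0// ltW.
  rewrite -(subrK (c * (u - 1)) (y - 1)) mulrDl -normrM addrC.
  by rewrite (le_trans (ler_normD _ _))// lerD2l.
have tp := crude _ _ _ t1 tC; have sq := crude _ _ _ s1 sC.
rewrite (_ : _ - q * (s - 1) = (t `^ p - 1) * (s `^ q - 1) +
  (t `^ p - 1 - p * (t - 1)) + (s `^ q - 1 - q * (s - 1))); last by ring.
have b1 : `|t `^ p - 1 - p * (t - 1)| <= e / 4 * r.
  rewrite (le_trans t1)// (le_trans (ler_wpM2l (ltW e10) tC))//.
  by rewrite mulrA ler_wpM2r.
have b2 : `|s `^ q - 1 - q * (s - 1)| <= e / 4 * r.
  rewrite (le_trans s1)// (le_trans (ler_wpM2l (ltW e10) sC))//.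
  by rewrite mulrA ler_wpM2r.
have b3 : `|(t `^ p - 1) * (s `^ q - 1)| <= e / 4 * r.
  rewrite normrM; apply: (@le_trans _ _ (P * r * r)).
    apply: le_trans (ler_pM _ _ tp sq) _ => //.
    by rewrite le_eqVlt; apply/orP; left; apply/eqP; rewrite /P; ring.
  rewrite ler_wpM2r//; move: re; rewrite ltr_pdivlMr// => re.
  by rewrite ler_pdivlMr// (le_trans _ (ltW re))//; nra.
apply: le_trans (ler_normD _ _) _.
apply: le_trans (lerD (ler_normD _ _) (lexx _)) _.
apply: le_trans (lerD (lerD b3 b1) b2) _.
by rewrite -!mulrDl ler_wpM2r//; lra.
Qed.

End DifferentiationUnderIntegral.

(** * First-order expansion of the potential kernel *)

Section Kernel.
Context {R : realType} (d : nat).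
Notation pts := (d.-tuple (measurableTypeR R)).
Implicit Types (x v : 'rV[R]_d.+1) (y : pts).

(** The coordinates other than the last one, indexed as in [boundary_point]. *)
Definition tangential x (j : 'I_d) : R := x 0 (lift ord_max j).

Definition sqdist x y : R :=
  \sum_(j < d) ((tnth y j : R) - tangential x j) ^+ 2 + last_coord x ^+ 2.

Lemma coord_le_mx_norm v i : `|v 0 i| <= `|v|.
Proof.
rewrite [`|v|]mx_normrE.
exact: (le_bigmax _ (fun p : 'I_1 * 'I_d.+1 => `|v p.1 p.2|) (0, i)).
Qed.

Lemma enorm_boundary_point x y :
  enorm (boundary_point y - x) = Num.sqrt (sqdist x y).
Proof.
rewrite /enorm /sqdist (bigD1_ord ord_max)//= addrC; congr (Num.sqrt (_ + _)).
  apply: eq_bigr => j _; rewrite !mxE liftK /tangential.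
  by [].
by rewrite !mxE unlift_none sub0r sqrrN.
Qed.

Lemma sqdist_ge x y : last_coord x ^+ 2 <= sqdist x y.
Proof. by rewrite lerDr sumr_ge0// => j _; exact: sqr_ge0. Qed.

Lemma sqdist_gt0 x y : half_space x -> 0 < sqdist x y.
Proof. by move=> hx; apply: lt_le_trans (sqdist_ge x y); rewrite exprn_gt0. Qed.

Lemma potential_integrandE (alpha beta : R) (f : pts -> R) x y : half_space x ->
  potential_integrand alpha beta f x y =
  last_coord x `^ (alpha * beta) * sqdist x y `^ (- (beta / 2)) * f y.
Proof.
move=> hx; rewrite /potential_integrand enorm_boundary_point; congr (_ * _).
rewrite powRM ?powR_ge0 ?invr_ge0 ?sqrtr_ge0// -powRrM; congr (_ * _).
rewrite -powR12_sqrt; last exact/ltW/sqdist_gt0.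
by rewrite -powRN -powRrM; congr (_ `^ _); field.
Qed.

(** The derivative in the direction [v] of [log (sqdist x y)] with respect to
    [x]. *)
Definition sqdist_slope x v y : R :=
  (\sum_(j < d) (- 2 * ((tnth y j : R) - tangential x j)) * tangential v j +
    2 * last_coord x * last_coord v) / sqdist x y.

Lemma sqdist_shift x v y : half_space x ->
  sqdist (v + x) y / sqdist x y - 1 - sqdist_slope x v y =
  (\sum_(j < d) tangential v j ^+ 2 + last_coord v ^+ 2) / sqdist x y.
Proof.
move=> /(sqdist_gt0 y) r0; rewrite /sqdist_slope.
have -> : sqdist (v + x) y = sqdist x y +
    (\sum_(j < d) (- 2 * ((tnth y j : R) - tangential x j)) * tangential v j +
      2 * last_coord x * last_coord v) +
    (\sum_(j < d) tangential v j ^+ 2 + last_coord v ^+ 2).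
  rewrite /sqdist; have -> : last_coord (v + x) = last_coord v + last_coord x.
    by rewrite /last_coord mxE.
  rewrite (eq_bigr (fun j => ((tnth y j : R) - tangential x j) ^+ 2 +
    (- 2 * ((tnth y j : R) - tangential x j)) * tangential v j +
    tangential v j ^+ 2)); last first.
    by move=> j _; rewrite /tangential mxE; ring.
  by rewrite !big_split/=; ring.
by field; rewrite gt_eqF.
Qed.

(** Every coordinate of [y - x] is at most the square root of [sqdist x y],
    which is itself at least the height of [x]; hence the constants do not
    depend on [y]. *)
Lemma sqdist_shift_bounds x v y : half_space x -> `|v| <= last_coord x ->
  `|sqdist (v + x) y / sqdist x y - 1| <= 3 * d.+1%:R / last_coord x * `|v| /\
  `|sqdist (v + x) y / sqdist x y - 1 - sqdist_slope x v y| <=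
    d.+1%:R / last_coord x ^+ 2 * `|v| ^+ 2.
Proof.
move=> hx vh; have h0 : 0 < last_coord x by [].
have r0 := sqdist_gt0 y hx.
pose r := `|v|; have r_ge0 : 0 <= r by exact: normr_ge0.
have vj j : `|tangential v j| <= r by exact: coord_le_mx_norm.
have vn : `|last_coord v| <= r by exact: coord_le_mx_norm.
have sq_le (a : R) : `|a| <= r -> a ^+ 2 <= r ^+ 2.
  by move=> ar; rewrite -real_normK ?num_real// lerXn2r// nnegrE.
pose q := Num.sqrt (sqdist x y).
have q2 : q ^+ 2 = sqdist x y by rewrite sqr_sqrtr// ltW.
have q0 : 0 < q by rewrite sqrtr_gt0.
have abs_q (a : R) : a ^+ 2 <= sqdist x y -> `|a| <= q.
  by move=> aq; rewrite -sqrtr_sqr ler_wsqrtr.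
have hq : last_coord x <= q.
  by rewrite -[last_coord x]gtr0_norm//; apply: abs_q; exact: sqdist_ge.
have yj j : `|(tnth y j : R) - tangential x j| <= q.
  apply: abs_q; rewrite /sqdist (bigD1 j)//= -addrA lerDl.
  by rewrite addr_ge0 ?sqr_ge0// sumr_ge0// => i _; exact: sqr_ge0.
have quad : `|sqdist (v + x) y / sqdist x y - 1 - sqdist_slope x v y| <=
    d.+1%:R / last_coord x ^+ 2 * r ^+ 2.
  rewrite sqdist_shift// ger0_norm; last first.
    rewrite divr_ge0 ?(ltW r0)// addr_ge0 ?sqr_ge0//.
    by apply: sumr_ge0 => j _; exact: sqr_ge0.
  rewrite mulrAC ler_pM ?invr_ge0 ?(ltW r0)//.
  - rewrite addr_ge0 ?sqr_ge0//.
    by apply: sumr_ge0 => j _; exact: sqr_ge0.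
  - rewrite -natr1 mulrDl mul1r lerD ?sq_le//.
    rewrite (le_trans (ler_sum _ (fun j _ => sq_le _ (vj j))))//.
    by rewrite sumr_const card_ord mulr_natl.
  - by rewrite lef_pV2 ?posrE ?exprn_gt0// sqdist_ge.
split=> //.
have slope : `|sqdist_slope x v y| <= 2 * d.+1%:R / last_coord x * r.
  rewrite /sqdist_slope normrM normfV (gtr0_norm r0) ler_pdivrMr// -q2.
  apply: (@le_trans _ _ (2 * d.+1%:R * q * r)); last first.
    have qq : q <= q ^+ 2 / last_coord x.
      by rewrite ler_pdivlMr// expr2 ler_wpM2l// ltW.
    rewrite (_ : _ * q ^+ 2 = 2 * d.+1%:R * r * (q ^+ 2 / last_coord x)).
      by rewrite mulrAC ler_wpM2l// mulr_ge0.
    by field; rewrite gt_eqF.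
  apply: le_trans (ler_normD _ _) _.
  rewrite (_ : 2 * d.+1%:R * q * r = 2 * d%:R * q * r + 2 * q * r); last first.
    by rewrite -[d.+1%:R]natr1; ring.
  apply: lerD.
    apply: le_trans (ler_norm_sum _ _ _) _.
    apply: (@le_trans _ _ (\sum_(j < d) 2 * q * r)).
      apply: ler_sum => j _; rewrite !normrM normrN normr_nat.
      by rewrite ler_pM// ?mulr_ge0// ler_wpM2l.
    rewrite sumr_const card_ord -mulr_natr le_eqVlt; apply/orP; left.
    by apply/eqP; ring.
  rewrite !normrM (gtr0_norm h0) normr_nat.
  by rewrite ler_pM// ?mulr_ge0// ?(ltW h0)// ler_wpM2l.
rewrite -[X in `|X|](subrK (sqdist_slope x v y)).
apply: le_trans (ler_normD _ _) _.
apply: le_trans (lerD quad slope) _.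
have rh : r / last_coord x <= 1 by rewrite ler_pdivrMr// mul1r.
rewrite (_ : d.+1%:R / _ * _ =
  d.+1%:R * (r / last_coord x) * (r / last_coord x)); last first.
  by field; rewrite gt_eqF.
rewrite (_ : 2 * _ / _ * _ = 2 * d.+1%:R * (r / last_coord x)); last first.
  by field; rewrite gt_eqF.
rewrite -/r (_ : 3 * _ / _ * _ =
  d.+1%:R * (r / last_coord x) + 2 * d.+1%:R * (r / last_coord x)); last first.
  by field; rewrite gt_eqF.
by rewrite lerD2r ler_piMr// mulr_ge0// divr_ge0// ltW.
Qed.

(** The logarithmic derivative in the direction [v] of
    [last_coord x ^ p * sqdist x y ^ q]; for the potential, [p = alpha beta] and
    [q = - beta / 2]. *)
Definition kernel_slope (p q : R) x v y : R :=
  p * (last_coord v / last_coord x) + q * sqdist_slope x v y.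

(** The quotient of the kernels at [v + x] and [x] is [t^p s^q], to which
    [powR_mul_first_order] applies with [r = |v|]; the quadratic part of
    [sqdist (v + x) y] only adds a term of order [|v|^2]. *)
Lemma kernel_first_order (p q e : R) x : 0 < e -> half_space x ->
  \forall v \near (0 : 'rV[R]_d.+1), half_space (v + x) /\
   forall y,
    `|last_coord (v + x) `^ p * sqdist (v + x) y `^ q -
      last_coord x `^ p * sqdist x y `^ q * (1 + kernel_slope p q x v y)| <=
    e * `|v| * (last_coord x `^ p * sqdist x y `^ q).
Proof.
move=> e0 hx; have h0 : 0 < last_coord x by [].
pose h := last_coord x.
pose C : R := 3 * d.+1%:R / h.
pose D : R := d.+1%:R / h ^+ 2.
have C0 : 0 <= C by rewrite divr_ge0 ?(ltW h0)// mulr_ge0.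
have D0 : 0 <= D by rewrite divr_ge0 ?sqr_ge0.
have e2 : 0 < e / 2 by rewrite divr_gt0.
have [eta eta0 Heta] := powR_mul_first_order p q e2 C0.
have qD : 0 < `|q| * D + 1 by rewrite ltr_wpDl// mulr_ge0.
(* [h / 2] keeps [v + x] in the half space, [eta] is the range of the expansion
   of [t^p s^q], and the last bound absorbs the quadratic term [D * |v| ^ 2]. *)
pose dl := Num.min (h / 2) (Num.min eta (e / 2 / (`|q| * D + 1))).
have dl0 : 0 < dl by rewrite !lt_min eta0 !divr_gt0.
apply/nbhs_ballP; exists dl => //= v.
rewrite -ball_normE /ball_/= sub0r normrN !lt_min => /and3P[vh veta ve].
have vn : `|last_coord v| <= `|v| by exact: coord_le_mx_norm.
have vlt : `|v| < h.
  by apply: lt_trans vh _; rewrite ltr_pdivrMr// ltr_pMr// ltr1n.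
have hvx : last_coord (v + x) = last_coord v + h by rewrite /last_coord mxE.
have hv : half_space (v + x).
  rewrite /half_space/= hvx; have := le_lt_trans vn vlt.
  by rewrite ltr_norml => /andP[+ _]; lra.
split=> // y.
have r0 := sqdist_gt0 y hx; have rv0 := sqdist_gt0 y hv.
have [b1 b2] := sqdist_shift_bounds y hx (ltW vlt).
pose t := last_coord (v + x) / h; pose s := sqdist (v + x) y / sqdist x y.
have t1 : t - 1 = last_coord v / h.
  by rewrite /t hvx; field; rewrite gt_eqF.
have tC : `|t - 1| <= C * `|v|.
  rewrite t1 normrM normfV (gtr0_norm h0) ler_pdivrMr// /C.
  rewrite (_ : _ * h = 3 * d.+1%:R * `|v|); last by field; rewrite gt_eqF.
  rewrite (le_trans vn)// ler_peMl// -natrM ler1n.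
  by [].
have main := Heta t s `|v| (normr_ge0 v) veta tC b1.
have pE : last_coord (v + x) `^ p = h `^ p * t `^ p.
  rewrite -powRM ?(ltW h0) ?divr_ge0 ?(ltW hv) ?(ltW h0)//.
  by rewrite /t mulrC divfK// gt_eqF.
have qE : sqdist (v + x) y `^ q = sqdist x y `^ q * s `^ q.
  rewrite -powRM ?(ltW r0) ?divr_ge0 ?(ltW rv0) ?(ltW r0)//.
  by rewrite /s mulrC divfK// gt_eqF.
pose K := h `^ p * sqdist x y `^ q.
have K0 : 0 <= K by rewrite mulr_ge0 ?powR_ge0.
rewrite pE qE -/h -/K /kernel_slope -/h -t1.
rewrite (_ : _ - _ = K * ((t `^ p * s `^ q - 1 - p * (t - 1) - q * (s - 1)) +
    q * (s - 1 - sqdist_slope x v y))); last by rewrite /K; ring.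
rewrite normrM (ger0_norm K0) mulrC ler_wpM2r//.
apply: le_trans (ler_normD _ _) _.
rewrite (_ : e * `|v| = e / 2 * `|v| + e / 2 * `|v|); last by field.
apply: lerD => //; rewrite normrM.
apply: (@le_trans _ _ (`|q| * (D * `|v| ^+ 2))).
  by rewrite ler_wpM2l.
rewrite (_ : _ * (D * _) = `|q| * D * `|v| * `|v|); last by ring.
rewrite ler_wpM2r//; move: ve; rewrite ltr_pdivlMr// => /ltW; apply: le_trans.
rewrite (_ : `|v| * (_ + 1) = `|q| * D * `|v| + `|v|); last by ring.
by rewrite lerDl.
Qed.

End Kernel.

(** * Symmetries of the squared distance and its moments *)

Section GramMatrix.
Context {R : realType} (d : nat).
Notation pts := (d.-tuple (measurableTypeR R)).
Notation lam := (lebesgue_tuple R d).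
Implicit Types (x v : 'rV[R]_d.+1) (y : pts).

Definition centered x y : pts :=
  [tuple ((tnth y j : R) - tangential x j : measurableTypeR R) | j < d].

Lemma sqdist_centered x y :
  sqdist x y = sqnorm (centered x y) + last_coord x ^+ 2.
Proof.
by congr (_ + _); apply: eq_bigr => j _; rewrite tnth_mktuple.
Qed.

Lemma ge0_integral_centered x (F : pts -> \bar R) :
  measurable_fun setT F -> (forall y, (0 <= F y)%E) ->
  (\int[lam]_y F (centered x y) = \int[lam]_y F y)%E.
Proof.
move=> mF F0.
apply: (@ge0_integral_tuple_map _ d (fun j t => t - tangential x j)) => //.
- by move=> j; apply: measurable_funB.
- move=> j g mg g0; have := ge0_integral_affine (- tangential x j) ltr01 mg g0.
  by rewrite invr1 mul1e => <-; apply: eq_integral => t _; rewrite mul1r.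
Qed.

Lemma measurable_offset x j :
  measurable_fun setT (fun y => (tnth y j : R) - tangential x j).
Proof. by apply: measurable_funB => //; exact: measurable_coord. Qed.

Lemma measurable_sqdist_powR x s :
  measurable_fun setT (fun y => sqdist x y `^ s).
Proof.
apply: (measurableT_comp (measurable_powR s)).
apply: measurable_funD => //; apply: measurable_sum => j.
by apply: measurable_funX; exact: measurable_offset.
Qed.

Lemma integral_sqdist x s : half_space x -> d%:R / 2 < s ->
  (\int[lam]_y (sqdist x y `^ (- s))%:E =
   (pi `^ (d%:R / 2) * Gamma (s - d%:R / 2) / Gamma s *
     (last_coord x ^+ 2) `^ (d%:R / 2 - s))%:E)%E.
Proof.
move=> hx ds; have h2 : 0 < last_coord x ^+ 2 by rewrite exprn_gt0.
have s0 : 0 < s by rewrite (le_lt_trans _ ds)// divr_ge0.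
rewrite -(integral_tuple_powR s0 ds h2).
under eq_integral do rewrite sqdist_centered.
rewrite (ge0_integral_centered x
  (F := fun y => ((sqnorm y + last_coord x ^+ 2) `^ (- s))%:E))//; last first.
  by move=> y; rewrite lee_fin powR_ge0.
apply/measurable_EFinP; apply: (measurableT_comp (measurable_powR (- s))).
by apply: measurable_funD => //; exact: measurable_sqnorm.
Qed.

Lemma integral_offset_sqdist x j s : half_space x -> d%:R / 2 + 1 < s ->
  (\int[lam]_y (((tnth y j : R) - tangential x j) ^+ 2 *
      sqdist x y `^ (- s))%:E =
   (pi `^ (d%:R / 2) / 2 * Gamma (s - (d%:R / 2 + 1)) / Gamma s *
     (last_coord x ^+ 2) `^ (d%:R / 2 + 1 - s))%:E)%E.
Proof.
move=> hx ds; have h2 : 0 < last_coord x ^+ 2 by rewrite exprn_gt0.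
rewrite -(integral_tuple_sqr_powR j ds h2).
pose F y := ((tnth y j : R) ^+ 2 * (sqnorm y + last_coord x ^+ 2) `^ (- s))%:E.
transitivity (\int[lam]_y F (centered x y))%E;
  last apply: ge0_integral_centered.
- by apply: eq_integral => y _; rewrite /F sqdist_centered tnth_mktuple.
- apply/measurable_EFinP; apply: measurable_funM.
    by apply: measurable_funX; exact: measurable_coord.
  apply: (measurableT_comp (measurable_powR (- s))).
  by apply: measurable_funD => //; exact: measurable_sqnorm.
- by move=> y; rewrite lee_fin mulr_ge0 ?powR_ge0 ?sqr_ge0.
Qed.

Definition flip x (j : 'I_d) y : pts :=
  [tuple (if i == j then 2 * tangential x j - (tnth y j : R) else tnth y i
    : measurableTypeR R) | i < d].

Lemma flip_offset x j y i : (tnth (flip x j y) i : R) - tangential x i =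
  (-1) ^+ (i == j) * ((tnth y i : R) - tangential x i).
Proof.
rewrite tnth_mktuple; case: eqP => [->|_]; first by rewrite expr1; ring.
by rewrite expr0 mul1r.
Qed.

Lemma sqdist_flip x j y : sqdist x (flip x j y) = sqdist x y.
Proof.
congr (_ + _); apply: eq_bigr => i _; rewrite flip_offset exprMn.
by rewrite sqrr_sign mul1r.
Qed.

(** The reflection preserves Lebesgue measure and exchanges the positive and
    negative parts of [F], so that their integrals cancel. *)
Lemma Rintegral_odd x j (F : pts -> R) :
  measurable_fun setT F -> (forall y, F (flip x j y) = - F y) ->
  \int[lam]_y F y = 0.
Proof.
move=> mF odd; rewrite /Rintegral integralE.
pose phi i (t : R) := if i == j then 2 * tangential x j - t else t.
have mEF : measurable_fun setT (EFin \o F) by exact/measurable_EFinP.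
have -> : (\int[lam]_y ((EFin \o F)^\- y) = \int[lam]_y ((EFin \o F)^\+ y))%E.
  rewrite -(@ge0_integral_tuple_map _ d phi (EFin \o F)^\+%E); last 4 first.
  - move=> i; rewrite /phi; case: (i == j) => //.
    by apply: measurable_funB.
  - move=> i g mg g0; rewrite /phi; case: (i == j) => //.
    rewrite -(ge0_integral_opp mg g0).
    have mgN : measurable_fun setT (fun t : R => g (- t)).
      exact: measurableT_comp.
    have := ge0_integral_affine (- (2 * tangential x j)) ltr01 mgN
      (fun t => g0 (- t)).
    rewrite invr1 mul1e => <-; apply: eq_integral => t _.
    by rewrite mul1r opprB.
  - exact: measurable_funepos.
  - by move=> y; exact: funepos_ge0.
  apply: eq_integral => y _.
  have -> : [tuple (phi i (tnth y i) : measurableTypeR R) | i < d] = flip x j y.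
    by apply: eq_from_tnth => i; rewrite !tnth_mktuple /phi; case: eqP => [->|].
  by rewrite funenegE funeposE/= odd EFinN.
by case: (integral _ _ _) => [r| |] //=; rewrite subrr.
Qed.

End GramMatrix.

(** * The kernels of the partial derivatives and their Gram matrix *)

Section GradientKernel.
Context {R : realType} (d : nat).
Notation pts := (d.-tuple (measurableTypeR R)).
Notation lam := (lebesgue_tuple R d).
Implicit Types (x v : 'rV[R]_d.+1) (y : pts).

(** Up to [gradient_scale], the derivative of the potential kernel in the
    [i]-th coordinate of [x]; the factor [last_coord x] of the tangential
    kernels makes that scale common to all directions. *)
Definition grad_kernel (alpha beta : R) x (i : 'I_d.+1) y : R :=
  if unlift ord_max i is Some j then
    last_coord x * (((tnth y j : R) - tangential x j) *
      sqdist x y `^ (- (beta / 2 + 1)))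
  else alpha * sqdist x y `^ (- (beta / 2)) -
    last_coord x ^+ 2 * sqdist x y `^ (- (beta / 2 + 1)).

Definition sqdist_mass x (s : R) : R :=
  pi `^ (d%:R / 2) * Gamma (s - d%:R / 2) / Gamma s *
     (last_coord x ^+ 2) `^ (d%:R / 2 - s).

Lemma integrable_sqdist x s : half_space x -> d%:R / 2 < s ->
  lam.-integrable setT (EFin \o (fun y => sqdist x y `^ (- s))).
Proof.
move=> hx ds; apply/integrableP; split.
  by apply/measurable_EFinP; exact: measurable_sqdist_powR.
under eq_integral => y _ do rewrite /= ger0_norm ?powR_ge0//.
by rewrite integral_sqdist// ltry.
Qed.

Lemma Rintegral_sqdist x s : half_space x -> d%:R / 2 < s ->
  \int[lam]_y (sqdist x y `^ (- s)) = sqdist_mass x s.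
Proof. by move=> hx ds; rewrite /Rintegral integral_sqdist. Qed.

Lemma sqdist_Lfun2 x s : half_space x -> d%:R / 2 < 2 * s ->
  (fun y => sqdist x y `^ (- s)) \in L2 d.
Proof.
move=> hx ds; apply: integrable_sqr_Lfun2; first exact: measurable_sqdist_powR.
have := integrable_sqdist hx ds; apply: eq_integrable => // y _ /=.
rewrite -powR_mulrn ?powR_ge0// -powRrM; congr (_ `^ _)%:E; ring.
Qed.

Section Gram.
Variables (alpha beta : R) (x : 'rV[R]_d.+1).
Hypotheses (hx : half_space x) (db : d%:R / 2 < beta).

Let h := last_coord x.
Let h0 : 0 < h. Proof. exact: hx. Qed.

Lemma measurable_grad_kernel i :
  measurable_fun setT (grad_kernel alpha beta x i).
Proof.
rewrite /grad_kernel; case: unliftP => [j _|_].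
  apply: measurable_funM => //; apply: measurable_funM.
    exact: measurable_offset.
  exact: measurable_sqdist_powR.
by apply: measurable_funB; apply: measurable_funM => //;
  exact: measurable_sqdist_powR.
Qed.

Lemma grad_kernel_tangential j y :
  grad_kernel alpha beta x (lift ord_max j) y =
  h * (((tnth y j : R) - tangential x j) * sqdist x y `^ (- (beta / 2 + 1))).
Proof. by rewrite /grad_kernel liftK. Qed.

Lemma grad_kernel_normal y :
  grad_kernel alpha beta x ord_max y =
  alpha * sqdist x y `^ (- (beta / 2)) -
  h ^+ 2 * sqdist x y `^ (- (beta / 2 + 1)).
Proof. by rewrite /grad_kernel unlift_none. Qed.

Lemma sqr_grad_kernel_tangential j y :
  grad_kernel alpha beta x (lift ord_max j) y ^+ 2 =
  h ^+ 2 * (((tnth y j : R) - tangential x j) ^+ 2 *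
    sqdist x y `^ (- (beta + 2))).
Proof.
rewrite grad_kernel_tangential !exprMn -(powR_mulrn 2 (powR_ge0 _ _)) -powRrM.
by congr (_ * (_ * _ `^ _)); field.
Qed.

Lemma sqr_grad_kernel_normal y :
  grad_kernel alpha beta x ord_max y ^+ 2 =
  alpha ^+ 2 * sqdist x y `^ (- beta) -
  2 * alpha * h ^+ 2 * sqdist x y `^ (- (beta + 1)) +
  h ^+ 4 * sqdist x y `^ (- (beta + 2)).
Proof.
have r0 := sqdist_gt0 y hx.
rewrite grad_kernel_normal sqrrB !exprMn.
rewrite -!(powR_mulrn 2 (powR_ge0 _ _)) -!powRrM.
rewrite (_ : - (beta / 2) * 2 = - beta); last by field.
rewrite (_ : - (beta / 2 + 1) * 2 = - (beta + 2)); last by field.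
rewrite (_ : - (beta + 1) = - (beta / 2) + - (beta / 2 + 1)); last by field.
by rewrite powRDgt0//; ring.
Qed.

(** Twice the common squared norm of the tangential kernels. *)
Definition gram_scale : R :=
  pi `^ (d%:R / 2) * Gamma (beta + 1 - d%:R / 2) / Gamma (beta + 2) *
  (h ^+ 2) `^ (d%:R / 2 - beta).

(** The squared norm of the normal kernel divided by [gram_scale]; a quadratic
    polynomial in [alpha] because that kernel is affine in [alpha]. *)
Definition gram_factor : R :=
  alpha ^+ 2 * beta * (beta + 1) / (beta - d%:R / 2) - 2 * alpha * (beta + 1) +
  (beta + 1 - d%:R / 2).

Lemma Rintegral_sqr_tangential j :
  lam.-integrable setT
    (EFin \o (fun y => grad_kernel alpha beta x (lift ord_max j) y ^+ 2)) /\
  \int[lam]_y (grad_kernel alpha beta x (lift ord_max j) y ^+ 2) =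
  gram_scale / 2.
Proof.
have E : (\int[lam]_y (grad_kernel alpha beta x (lift ord_max j) y ^+ 2)%:E =
    (gram_scale / 2)%:E)%E.
  transitivity ((h ^+ 2)%:E *
      \int[lam]_y (((tnth y j : R) - tangential x j) ^+ 2 *
      sqdist x y `^ (- (beta + 2)))%:E)%E.
    rewrite -ge0_integralZl//.
    - by apply: eq_integral => y _; rewrite sqr_grad_kernel_tangential.
    - apply/measurable_EFinP; apply: measurable_funM.
        by apply: measurable_funX; exact: measurable_offset.
      exact: measurable_sqdist_powR.
    - by move=> y _; rewrite lee_fin mulr_ge0 ?sqr_ge0 ?powR_ge0.
    - by rewrite lee_fin sqr_ge0.
  rewrite integral_offset_sqdist//; last first.
    by rewrite [2]mulr2n addrA ltrD2r (lt_trans db)// ltrDl.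
  rewrite -EFinM; congr EFin; rewrite -/h /gram_scale.
  rewrite (_ : beta + 2 - (d%:R / 2 + 1) = beta + 1 - d%:R / 2); last by ring.
  have h2 : 0 < h ^+ 2 by rewrite exprn_gt0.
  rewrite (_ : d%:R / 2 - beta = 1 + (d%:R / 2 + 1 - (beta + 2))); last by ring.
  by rewrite (powRDgt0 1)// powRr1 ?(ltW h2)//; ring.
split; last by rewrite /Rintegral E.
apply/integrableP; split.
  apply/measurable_EFinP; apply: measurable_funX; exact: measurable_grad_kernel.
under eq_integral => y _ do rewrite /= ger0_norm ?sqr_ge0//.
by rewrite E ltry.
Qed.

(** The square is a combination of the powers [- beta], [- beta - 1] and
    [- beta - 2] of [sqdist]; the functional equation of Gamma reduces their
    integrals to the common scale. *)
Lemma Rintegral_sqr_normal :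
  lam.-integrable setT
    (EFin \o (fun y => grad_kernel alpha beta x ord_max y ^+ 2)) /\
  \int[lam]_y (grad_kernel alpha beta x ord_max y ^+ 2) =
  gram_scale * gram_factor.
Proof.
have b0 : 0 < beta by rewrite (le_lt_trans _ db)// divr_ge0.
have db1 : d%:R / 2 < beta + 1 by rewrite (lt_trans db)// ltrDl.
have db2 : d%:R / 2 < beta + 2 by rewrite (lt_trans db)// ltrDl.
have i0 := integrable_sqdist hx db.
have i1 := integrable_sqdist hx db1.
have i2 := integrable_sqdist hx db2.
have j0 := integrableZl measurableT (alpha ^+ 2) i0.
have j1 := integrableZl measurableT (2 * alpha * h ^+ 2) i1.
have j2 := integrableZl measurableT (h ^+ 4) i2.
have j01 := integrableB measurableT j0 j1.
split.
  have := integrableD measurableT j01 j2; apply: eq_integrable => // y _.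
  by rewrite /= sqr_grad_kernel_normal EFinD EFinB.
under eq_Rintegral do rewrite sqr_grad_kernel_normal.
rewrite RintegralD// RintegralB// !RintegralZl// !Rintegral_sqdist//.
rewrite /sqdist_mass -/h /gram_scale /gram_factor.
have h2 : 0 < h ^+ 2 by rewrite exprn_gt0.
have bd : 0 < beta - d%:R / 2 by rewrite subr_gt0.
pose H := (h ^+ 2) `^ (d%:R / 2 - beta).
have H1 : (h ^+ 2) `^ (d%:R / 2 - (beta + 1)) = H / h ^+ 2.
  rewrite (_ : d%:R / 2 - (beta + 1) = (d%:R / 2 - beta) + -1); last by ring.
  by rewrite (powRDgt0 _ (-1))// powR_inv1 ?(ltW h2).
have H2 : (h ^+ 2) `^ (d%:R / 2 - (beta + 2)) = H / h ^+ 4.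
  rewrite (_ : d%:R / 2 - (beta + 2) = d%:R / 2 - (beta + 1) + -1); last first.
    by ring.
  rewrite (powRDgt0 _ (-1))// powR_inv1 ?(ltW h2)// H1.
  by field; rewrite gt_eqF.
rewrite H1 H2 -/H.
have b1 : 0 < beta + 1 by rewrite addr_gt0.
have bd1 : 0 < beta - d%:R / 2 + 1 by rewrite addr_gt0.
have G0 := Gamma_gt0 b0.
have G1 := GammaS bd; have G2 := GammaS bd1.
have G3 := GammaS b0; have G4 := GammaS b1.
rewrite (_ : beta + 1 - d%:R / 2 = beta - d%:R / 2 + 1); last by ring.
rewrite (_ : beta + 2 - d%:R / 2 = beta - d%:R / 2 + 1 + 1); last by ring.
rewrite (_ : beta + 2 = beta + 1 + 1); last by ring.
rewrite G4 G3 G2 G1.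
move: (Gamma beta) (Gamma (beta - d%:R / 2)) G0 {G1 G2 G3 G4} => g g' g0.
have nz : beta * 2 - d%:R != 0 by rewrite gt_eqF// subr_gt0 -ltr_pdivrMr.
by field; rewrite nz !gt_eqF.
Qed.

Lemma grad_kernel_L2 i : grad_kernel alpha beta x i \in L2 d.
Proof.
apply: integrable_sqr_Lfun2; first exact: measurable_grad_kernel.
case: (unliftP ord_max i) => [j ->|->].
  by have [] := Rintegral_sqr_tangential j.
by have [] := Rintegral_sqr_normal.
Qed.

(** Of two distinct kernels at least one is tangential.  The reflection in its
    coordinate changes its sign and fixes the other one. *)
Lemma grad_kernel_orthogonal i i' : i != i' ->
  \int[lam]_y (grad_kernel alpha beta x i y *
    grad_kernel alpha beta x i' y) = 0.
Proof.
have flipK j (k : 'I_d.+1) y : k != lift ord_max j ->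
    grad_kernel alpha beta x k (flip x j y) = grad_kernel alpha beta x k y.
  rewrite /grad_kernel; case: unliftP => [l ->|-> _]; last first.
    by rewrite sqdist_flip.
  rewrite (inj_eq lift_inj) => /negbTE lj.
  by rewrite flip_offset sqdist_flip lj expr0 mul1r.
have flipN j y : grad_kernel alpha beta x (lift ord_max j) (flip x j y) =
    - grad_kernel alpha beta x (lift ord_max j) y.
  rewrite !grad_kernel_tangential flip_offset sqdist_flip eqxx expr1; ring.
have orth j k : k != lift ord_max j ->
    \int[lam]_y (grad_kernel alpha beta x (lift ord_max j) y *
      grad_kernel alpha beta x k y) = 0.
  move=> kj; apply: (@Rintegral_odd _ _ x j).
    by apply: measurable_funM; exact: measurable_grad_kernel.
  by move=> y; rewrite flipN flipK// mulNr.
case: (unliftP ord_max i) => [j ->|-> ii'].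
  by rewrite eq_sym; exact: orth.
case: (unliftP ord_max i') ii' => [j -> ij|->]; last by rewrite eqxx.
by under eq_Rintegral do rewrite mulrC; exact: orth.
Qed.

End Gram.
End GradientKernel.

(** * The gradient of the potential *)

Section GradientOfPotential.
Context {R : realType} (d : nat).
Notation pts := (d.-tuple (measurableTypeR R)).
Notation lam := (lebesgue_tuple R d).
Variables (k alpha beta : R).
Hypothesis db : d%:R / 2 < beta.
Implicit Types (x v : 'rV[R]_d.+1) (y : pts) (f : pts -> R).

Definition gradient_scale x : R := beta * last_coord x `^ (alpha * beta - 1).

Lemma integrable_potential f x : half_space x -> f \in L2 d ->
  lam.-integrable setT (EFin \o potential_integrand alpha beta f x).
Proof.
move=> hx lf.
have rf : (fun y => sqdist x y `^ (- (beta / 2))) \in L2 d.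
  by apply: sqdist_Lfun2 => //; rewrite (_ : 2 * (beta / 2) = beta)//; field.
have := integrableZl measurableT (last_coord x `^ (alpha * beta))
  (Lfun2_integrable_mul rf lf).
apply: eq_integrable => // y _.
by rewrite /= potential_integrandE// -mulrA.
Qed.

(** Identifies the linear term of [kernel_first_order] with the combination of
    the [grad_kernel]s prescribed by [v]. *)
Lemma sum_grad_kernel x v y : half_space x ->
  \sum_(i < d.+1) v 0 i * (gradient_scale x * grad_kernel alpha beta x i y) =
  last_coord x `^ (alpha * beta) * sqdist x y `^ (- (beta / 2)) *
    kernel_slope (alpha * beta) (- (beta / 2)) x v y.
Proof.
move=> hx; have h0 : 0 < last_coord x by [].
have r0 := sqdist_gt0 y hx.
rewrite (bigD1_ord ord_max)//= grad_kernel_normal.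
under eq_bigr do rewrite grad_kernel_tangential.
rewrite /gradient_scale /kernel_slope /sqdist_slope.
rewrite (powRDgt0 (alpha * beta) (-1))// (powR_inv1 (ltW h0)).
rewrite opprD (powRDgt0 (- (beta / 2)) (-1))// (powR_inv1 (ltW r0)).
rewrite (eq_bigr (fun j => beta * last_coord x `^ (alpha * beta) *
    sqdist x y `^ (- (beta / 2)) / sqdist x y / (- 2) *
    ((- 2 * ((tnth y j : R) - tangential x j)) * tangential v j))); last first.
  by move=> j _; rewrite -/(tangential v j); field; rewrite !gt_eqF.
rewrite -mulr_sumr -/(last_coord v); field.
by rewrite !gt_eqF.
Qed.

Lemma partial_potential f x : half_space x -> f \in L2 d ->
  differentiable (potential k alpha beta f) x /\
  forall i, partial i (potential k alpha beta f) x =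
    k * gradient_scale x * \int[lam]_y (grad_kernel alpha beta x i y * f y).
Proof.
move=> hx lf.
have ig i : lam.-integrable setT
    (EFin \o (fun y => grad_kernel alpha beta x i y * f y)).
  by apply: Lfun2_integrable_mul => //; exact: grad_kernel_L2.
pose G i y := gradient_scale x * (grad_kernel alpha beta x i y * f y).
pose W y := `|potential_integrand alpha beta f x y|.
have iG i : lam.-integrable setT (EFin \o G i).
  exact: (integrableZl measurableT (gradient_scale x) (ig i)).
have [||| du pu] := @differentiable_integral R _ _ lam d
  (potential_integrand alpha beta f) G W x _ iG.
- have := @kernel_first_order R d 1 1 1 x ltr01 hx; apply: filterS => v [hv _].
  exact: integrable_potential.
- exact: (integrable_norm (integrable_potential hx lf)).
- move=> e e0.
  have := @kernel_first_order R d (alpha * beta) (- (beta / 2)) e x e0 hx.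
  apply: filterS => v [hv H] y; have := H y.
  rewrite /W !potential_integrandE//.
  set K := last_coord x `^ _ * _; set K' := last_coord (v + x) `^ _ * _.
  have K0 : 0 <= K by rewrite mulr_ge0 ?powR_ge0.
  have -> : \sum_(i < d.+1) v 0 i * G i y =
      K * kernel_slope (alpha * beta) (- (beta / 2)) x v y * f y.
    rewrite -sum_grad_kernel// mulr_suml; apply: eq_bigr => i _.
    by rewrite /G; ring.
  move=> KK; rewrite normrM (ger0_norm K0) mulrA.
  rewrite (_ : _ - _ - _ = (K' - K *
    (1 + kernel_slope (alpha * beta) (- (beta / 2)) x v y)) * f y); last first.
    by ring.
  by rewrite normrM ler_wpM2r.
split; first exact: (differentiableZ k du).
move=> i; rewrite -mulrA -RintegralZl//.
rewrite -(pu i) /partial; apply: (deriveZ k).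
exact: diff_derivable.
Qed.

Lemma enorm_gradient_potential f x : half_space x -> f \in L2 d ->
  enorm (gradient (potential k alpha beta f) x) =
  `|k| * gradient_scale x * Num.sqrt
    (\sum_(i < d.+1) (\int[lam]_y (grad_kernel alpha beta x i y * f y)) ^+ 2).
Proof.
move=> hx lf; have [_ pE] := partial_potential hx lf.
have b0 : 0 < beta by rewrite (le_lt_trans _ db)// divr_ge0.
rewrite /enorm; under eq_bigr do rewrite mxE pE exprMn.
rewrite -mulr_sumr sqrtrM ?sqr_ge0// sqrtr_sqr normrM.
by rewrite (ger0_norm (_ : 0 <= gradient_scale x))// mulr_ge0 ?powR_ge0 ?ltW.
Qed.

Lemma partial_le_gradient (u : 'rV[R]_d.+1 -> R) x i :
  `|partial i u x| <= enorm (gradient u x).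
Proof.
rewrite -sqrtr_sqr ler_wsqrtr// (bigD1 i)//= mxE lerDl.
by apply: sumr_ge0 => j _; exact: sqr_ge0.
Qed.

Lemma L2norm_ge0 f : 0 <= L2norm f.
Proof. by rewrite fine_ge0// Lnorm_ge0. Qed.

Lemma L2norm_sqr f : L2norm f ^+ 2 = \int[lam]_y (f y ^+ 2).
Proof. exact: Lnorm2_sqr. Qed.

Lemma sharp_of_extremal (Q : (pts -> R) -> R) (C : R) f0 :
  (forall f, f \in L2 d -> Q f <= C * L2norm f) ->
  f0 \in L2 d -> 0 < L2norm f0 -> C * L2norm f0 <= Q f0 ->
  sharp_coefficient Q C.
Proof.
move=> bound lf0 f00 Qf0; split=> // C' bound'.
by have := le_trans Qf0 (bound' _ lf0); rewrite ler_pM2r.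
Qed.

(** The upper bound is Bessel's inequality.  For [f = g_(i0)] the derivative in
    direction [i0] alone already reaches it, which is why that derivative has
    the same sharp coefficient as the gradient. *)
Lemma sharp_gradient x (i0 : 'I_d.+1) (M : R) : half_space x -> 0 < M ->
  (forall i, \int[lam]_y (grad_kernel alpha beta x i y ^+ 2) <= M) ->
  \int[lam]_y (grad_kernel alpha beta x i0 y ^+ 2) = M ->
  sharp_coefficient
    (fun f => enorm (gradient (potential k alpha beta f) x))
    (`|k| * gradient_scale x * Num.sqrt M) /\
  sharp_coefficient
    (fun f => `|partial i0 (potential k alpha beta f) x|)
    (`|k| * gradient_scale x * Num.sqrt M).
Proof.
move=> hx M0 gM g0M.
have b0 : 0 < beta by rewrite (le_lt_trans _ db)// divr_ge0.
have s0 : 0 <= gradient_scale x by rewrite mulr_ge0 ?powR_ge0 ?ltW.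
have lg i : grad_kernel alpha beta x i \in L2 d by exact: grad_kernel_L2.
have upper f : f \in L2 d ->
    enorm (gradient (potential k alpha beta f) x) <=
    `|k| * gradient_scale x * Num.sqrt M * L2norm f.
  move=> lf; rewrite enorm_gradient_potential// -[leRHS]mulrA.
  apply: ler_wpM2l; first by rewrite mulr_ge0.
  rewrite -[L2norm f]ger0_norm ?L2norm_ge0// -sqrtr_sqr -sqrtrM ?(ltW M0)//.
  rewrite ler_wsqrtr// L2norm_sqr.
  apply: (bessel M0 lg) => //.
    by move=> i j; exact: grad_kernel_orthogonal.
pose g0 := grad_kernel alpha beta x i0.
have g0norm : L2norm g0 = Num.sqrt M.
  by rewrite -g0M -L2norm_sqr sqrtr_sqr ger0_norm ?L2norm_ge0.
have g0pos : 0 < L2norm g0 by rewrite g0norm sqrtr_gt0.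
have lower : `|k| * gradient_scale x * Num.sqrt M * L2norm g0 <=
    `|partial i0 (potential k alpha beta g0) x|.
  have [_ ->] := partial_potential hx (lg i0).
  rewrite g0norm -mulrA -expr2 sqr_sqrtr ?(ltW M0)//.
  under eq_Rintegral do rewrite -expr2.
  by rewrite g0M normrM (normrM k) (ger0_norm s0) (gtr0_norm M0).
split; apply: (@sharp_of_extremal _ _ g0) (lg i0) g0pos _ => //.
- exact: le_trans lower (partial_le_gradient _ _ _).
- by move=> f lf; apply: le_trans (upper f lf); exact: partial_le_gradient.
Qed.

End GradientOfPotential.

(** * The sharp constants *)

Section SharpConstants.
Context {R : realType} (d : nat).
Variables (alpha beta : R).
Hypothesis db : d%:R / 2 < beta.

Let m := 2 * beta - d%:R.

Let beta_gt0 : 0 < beta.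
Proof. by rewrite (le_lt_trans _ db)// divr_ge0. Qed.

Let m_gt0 : 0 < m.
Proof. by move: db; rewrite /m ltr_pdivrMr// mulrC subr_gt0. Qed.

Let lead := 2 * beta * (beta + 1).
Let lead_gt0 : 0 < lead.
Proof. by rewrite !mulr_gt0// addr_gt0. Qed.

Let disc := (1 + beta) * m * (beta - d%:R).

(** Completing the square: the discriminant simplifies because
    [m - beta = beta - d]. *)
Lemma gram_factor_disc :
  lead * m * (gram_factor d alpha beta - 1 / 2) =
  (lead * alpha - (1 + beta) * m) ^+ 2 - disc.
Proof.
rewrite /gram_factor /disc /lead (_ : beta - d%:R / 2 = m / 2); last first.
  by rewrite /m; field.
rewrite (_ : beta + 1 - d%:R / 2 = m / 2 + 1); last by rewrite /m; field.
rewrite (_ : beta - d%:R = m - beta); last by rewrite /m; ring.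
by field; rewrite gt_eqF.
Qed.

Lemma alpha1E : alpha1 d.+1 beta = ((1 + beta) * m - Num.sqrt disc) / lead.
Proof.
rewrite /alpha1 /disc /m /lead -natr1.
by congr ((_ * _ - Num.sqrt (_ * _ * _)) / _); ring.
Qed.

Lemma alpha2E : alpha2 d.+1 beta = ((1 + beta) * m + Num.sqrt disc) / lead.
Proof.
rewrite /alpha2 /disc /m /lead -natr1.
by congr ((_ * _ + Num.sqrt (_ * _ * _)) / _); ring.
Qed.

Lemma gram_factor_outer :
  beta <= d.+1%:R - 1 \/ (d.+1%:R - 1 < beta /\
    (alpha <= alpha1 d.+1 beta \/ alpha2 d.+1 beta <= alpha)) ->
  1 / 2 <= gram_factor d alpha beta.
Proof.
rewrite -natr1 addrK => H; rewrite -subr_ge0.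
rewrite -(pmulr_rge0 _ (mulr_gt0 lead_gt0 m_gt0)) gram_factor_disc subr_ge0.
case: H => [bd|[bd]].
  apply: (@le_trans _ _ 0); last exact: sqr_ge0.
  by rewrite mulr_ge0_le0 ?subr_le0// mulr_ge0 ?(ltW m_gt0)// addr_ge0// ltW.
have d0 : 0 <= disc.
  rewrite mulr_ge0 ?subr_ge0 ?(ltW bd)// mulr_ge0 ?(ltW m_gt0)//.
  by rewrite addr_ge0// ltW.
rewrite alpha1E alpha2E ler_pdivlMr// ler_pdivrMr// -{3}(sqr_sqrtr d0).
have := sqrtr_ge0 disc; set s := Num.sqrt disc; rewrite [alpha * lead]mulrC.
move: (lead * alpha) ((1 + beta) * m) => X Y s0.
rewrite -subr_ge0 subr_sqr; case=> H.
  by rewrite mulr_le0; lra.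
by rewrite mulr_ge0; lra.
Qed.

Lemma gram_factor_inner :
  d.+1%:R - 1 < beta -> alpha1 d.+1 beta < alpha < alpha2 d.+1 beta ->
  gram_factor d alpha beta <= 1 / 2.
Proof.
rewrite -natr1 addrK => bd H; rewrite -subr_le0.
rewrite -(pmulr_rle0 _ (mulr_gt0 lead_gt0 m_gt0)) gram_factor_disc subr_le0.
have d0 : 0 <= disc.
  rewrite mulr_ge0 ?subr_ge0 ?(ltW bd)// mulr_ge0 ?(ltW m_gt0)//.
  by rewrite addr_ge0// ltW.
move: H; rewrite alpha1E alpha2E ltr_pdivrMr// ltr_pdivlMr// -{3}(sqr_sqrtr d0).
have := sqrtr_ge0 disc; set s := Num.sqrt disc; rewrite [alpha * lead]mulrC.
move: (lead * alpha) ((1 + beta) * m) => X Y s0 /andP[H1 H2].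
by rewrite -subr_ge0 subr_sqr mulr_ge0; lra.
Qed.

Lemma gram_scale_gt0 (x : 'rV[R]_d.+1) : half_space x -> 0 < gram_scale beta x.
Proof.
move=> hx; rewrite mulr_gt0 ?powR_gt0 ?exprn_gt0//.
have G1 : 0 < Gamma (beta + 1 - d%:R / 2).
  by apply: Gamma_gt0; rewrite subr_gt0 (lt_trans db)// ltrDl.
have G2 : 0 < Gamma (beta + 2) by apply: Gamma_gt0; rewrite addr_gt0.
move: (Gamma _) (Gamma _) G1 G2 => g g' G1 G2.
by rewrite divr_gt0// mulr_gt0// powR_gt0 ?pi_gt0.
Qed.

(** Collects the powers of the height: [alpha beta - 1 + d/2 - beta] is the
    opposite of the exponent in the statement. *)
Lemma gradient_scale_gram (x : 'rV[R]_d.+1) (k A : R) : half_space x ->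
  `|k| * gradient_scale alpha beta x * Num.sqrt (gram_scale beta x * A) =
  `|k| * beta * Num.sqrt
    (pi `^ ((d.+1%:R - 1) / 2) * Gamma ((2 * beta + 3 - d.+1%:R) / 2)
       / Gamma (beta + 2) * A) /
  last_coord x `^ (beta * (1 - alpha) + (3 - d.+1%:R) / 2).
Proof.
move=> hx; have h0 : 0 < last_coord x by [].
rewrite /gradient_scale /gram_scale -[d.+1%:R]natr1 addrK.
rewrite (_ : (2 * beta + 3 - (d%:R + 1)) / 2 = beta + 1 - d%:R / 2); last first.
  by field.
rewrite (powR_sqr _ (ltW h0)).
set H := last_coord x `^ (d%:R / 2 - beta); set S := pi `^ _ * _ / _.
rewrite (_ : S * H ^+ 2 * A = H ^+ 2 * (S * A)); last by ring.
rewrite sqrtrM ?sqr_ge0// sqrtr_sqr (ger0_norm (powR_ge0 _ _ : 0 <= H)).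
rewrite -powRN (_ : - (beta * (1 - alpha) + _) =
  (alpha * beta - 1) + (d%:R / 2 - beta)); last by field.
by rewrite (powRDgt0 (alpha * beta - 1))// -/H; ring.
Qed.

End SharpConstants.

Theorem theorem3 (R : realType) (n : nat) (alpha beta k : R)
    (x : 'rV[R]_(n.-1.+1)) :
  (3 <= n)%N -> 0 <= alpha -> (n%:R - 1) / 2 < beta ->
  half_space x ->
  let u := @potential R n.-1 k alpha beta in
  let grad_u f := enorm (gradient (u f) x) in
  let dn_u f := `|partial ord_max (u f) x| in
  let xpow := last_coord x `^ (beta * (1 - alpha) + (3 - n%:R) / 2) in
  (forall f, f \in L2 n.-1 ->
     (lebesgue_tuple R n.-1).-integrable setT
       (EFin \o potential_integrand alpha beta f x) /\
     differentiable (u f) x) /\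
  (beta <= n%:R - 1 \/
   (n%:R - 1 < beta /\ (alpha <= alpha1 n beta \/ alpha2 n beta <= alpha)) ->
     sharp_coefficient grad_u (C_outer n k alpha beta / xpow) /\
     sharp_coefficient dn_u (C_outer n k alpha beta / xpow)) /\
  (n%:R - 1 < beta /\ alpha1 n beta < alpha < alpha2 n beta ->
     sharp_coefficient grad_u (C_inner n k beta / xpow)).
Proof.
case: n x => [//|d] /= x d2 _ + hx; rewrite -{1}natr1 addrK => db.
set xpow := last_coord x `^ _.
have S0 := gram_scale_gt0 db hx.
have tangentE j := (Rintegral_sqr_tangential alpha hx db j).2.
have normalE := (Rintegral_sqr_normal alpha hx db).2.
have cases (M : R) : gram_scale beta x / 2 <= M ->
    gram_scale beta x * gram_factor d alpha beta <= M ->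
    forall i,
      \int[lebesgue_tuple R d]_y (grad_kernel alpha beta x i y ^+ 2) <= M.
  move=> tM nM i; case: (unliftP ord_max i) => [j ->|->].
    by rewrite tangentE.
  by rewrite normalE.
split; [|split].
- move=> f lf; split; first exact: integrable_potential.
  by have [] := partial_potential k alpha db hx lf.
- move=> /(gram_factor_outer db) F2.
  have CE : `|k| * gradient_scale alpha beta x *
      Num.sqrt (gram_scale beta x * gram_factor d alpha beta) =
      C_outer d.+1 k alpha beta / xpow.
    rewrite gradient_scale_gram// /C_outer; congr (_ * Num.sqrt (_ * _) / _).
    have m0 : beta * 2 - d%:R != 0.
      by rewrite gt_eqF// subr_gt0 -ltr_pdivrMr.
    rewrite /gram_factor -[d.+1%:R]natr1; field.
    by rewrite (_ : _ - _ = beta * 2 - d%:R)//; ring.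
  rewrite -CE; apply: sharp_gradient => //.
    by rewrite mulr_gt0// (lt_le_trans _ F2).
  apply: cases => //.
  by rewrite ler_wpM2l ?(ltW S0)// -div1r.
- move=> [bd aa]; have F2 := gram_factor_inner db bd aa.
  have CE : `|k| * gradient_scale alpha beta x *
      Num.sqrt (gram_scale beta x * (1 / 2)) = C_inner d.+1 k beta / xpow.
    rewrite gradient_scale_gram// /C_inner; congr (_ * Num.sqrt _ / _).
    by rewrite div1r invfM; ring.
  pose j0 : 'I_d := Ordinal (ltnW d2 : (0 < d)%N).
  rewrite -CE; have [] // := @sharp_gradient R d k alpha beta db x
    (lift ord_max j0) (gram_scale beta x * (1 / 2)) hx.
  + by rewrite mulr_gt0.
  + apply: cases; first by rewrite div1r.
    by rewrite ler_wpM2l ?(ltW S0).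
  + by rewrite tangentE div1r.
Qed.
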